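(* Let $q$ be an odd prime power, $\nu\ge2$, and let $z,\Delta,\Omega,\Lambda,P_1,G_{01},G_0$ be as in the context. Every subspace in $\Lambda\setminus\{P_1\}$ lies in the $G_{01}$-orbit of exactly one of the following subspaces (given by their matrix representations, with $a\in\{0,1\}$ and $b\in\Omega$), and distinct subspaces in this list lie in distinct $G_{01}$-orbits: $\varphi_1(r)=([\mathcal{A}_{2r},0^{(\nu-2r)}]\ \ I^{(\nu)}\ \ 0^{(\nu,2)})$ for $1\le r\le\lfloor\nu/2\rfloor$; $\varphi_2(r,a)=([-\tfrac12(1-za^2),\mathcal{A}_{2r},0^{(\nu-2r-1)}]\ \ I^{(\nu)}\ \ (E_1\ \ aE_1))$ for $0\le r\le\lfloor(\nu-1)/2\rfloor$; $\varphi_3(r,a)=([\mathcal{A}_{2r},0^{(\nu-2r)}]+[-\tfrac12(1-za^2),0^{(\nu-1)}]\ \ I^{(\nu)}\ \ (E_1\ \ aE_1))$ for $1\le r\le\lfloor\nu/2\rfloor$; $\varphi_4(r)=([0,\mathcal{A}_{2r},0^{(\nu-1-2r)}]+[-\tfrac12\Delta,0^{(\nu-2)}]\ \ I^{(\nu)}\ \ (E_1\ \ E_2))$ for $0\le r\le\lfloor(\nu-1)/2\rfloor$; $\varphi_5(r)=([Y,\mathcal{A}_{2r-2},0^{(\nu-1-2r)}]+[-\tfrac12\Delta,0^{(\nu-2)}]\ \ I^{(\nu)}\ \ (E_1\ \ E_2))$ for $1\le r\le\lfloor(\nu-1)/2\rfloor$; $\varphi_6(r)=([-\tfrac12\Delta,\mathcal{A}_{2r},0^{(\nu-2r-2)}]\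 \ I^{(\nu)}\ \ (E_1\ \ E_2))$ for $1\le r\le\lfloor(\nu-2)/2\rfloor$; $\varphi_7(r,b)=([b\mathcal{A}_2-\tfrac12\Delta,\mathcal{A}_{2r-2},0^{(\nu-2r)}]\ \ I^{(\nu)}\ \ (E_1\ \ E_2))$ for $1\le r\le\lfloor\nu/2\rfloor$; $\varphi_8(r)=([\mathcal{K},\mathcal{A}_{2r-4},0^{(\nu-2r)}]+[-\tfrac12\Delta,0^{(\nu-2)}]\ \ I^{(\nu)}\ \ (E_1\ \ E_2))$ for $2\le r\le\lfloor\nu/2\rfloor$; where $Y=\begin{pmatrix}0&0&1\\0&0&1\\-1&-1&0\end{pmatrix}$ and $\mathcal{K}=\begin{pmatrix}0&I^{(2)}\\-I^{(2)}&0\end{pmatrix}$. Moreover, the rank of $G_0$ on $\Lambda$ (the number of $G_{01}$-orbits on $\Lambda$, including $\{P_1\}$) equals $$\frac{q+7}{2}\left\lfloor\frac{\nu}{2}\right\rfloor+4\left\lfloor\frac{\nu-1}{2}\right\rfloor+\left\lfloor\frac{\nu-2}{2}\right\rfloor+3.$$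
   Context: $q$ is an odd prime power; $z\in\mathbb{F}_q$ is a fixed non-square such that $1-z$ is also a non-square; $\Delta=\mathrm{diag}(1,-z)$. Let $S_{2\nu+2,\Delta}=\begin{pmatrix}0&I^{(\nu)}&0\\ I^{(\nu)}&0&0\\0&0&\Delta\end{pmatrix}$ and $O_{2\nu+2,\Delta}(\mathbb{F}_q)=\{T\in GL_{2\nu+2}(\mathbb{F}_q): TS_{2\nu+2,\Delta}T^t=S_{2\nu+2,\Delta}\}$, acting on row vectors of $\mathbb{F}_q^{2\nu+2}$ by right multiplication and hence on subspaces; a subspace is identified with any matrix whose rows form a basis of it. $O_{2,\Delta}(\mathbb{F}_q)=\{S\in GL_2(\mathbb{F}_q):S\Delta S^t=\Delta\}$. Let $P_0$ and $P_1$ be the row spaces of $(I^{(\nu)}\ 0^{(\nu)}\ 0^{(\nu,2)})$ and $(0^{(\nu)}\ I^{(\nu)}\ 0^{(\nu,2)})$. $\Lambda$ is the set of subspaces with matrix representation $(A\ \ I^{(\nu)}\ \ Z)$ where $A\in M_\nu(\mathbb{F}_q)$, $Z\in M_{\nu,2}(\mathbb{F}_q)$, $A+A^t+Z\Delta Z^t=0$ (these are exactly the $\nu$-dimensional totally isotropic subspaces meeting $P_0$ trivially, i.e. the last subconstituent of the orthogonal dual polar graph with respect to $P_0$). $G_0$ is the stabilizer of $P_0$ in $O_{2\nu+2,\Delta}(\mathbb{F}_q)$ (it is transitive on $\Lambda$), and $G_{01}$ is the stabilizer of both $P_0$ and $P_1$; it consists of the matrices $[T,(T^t)^{-1},S]$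 with $T\in GL_\nu(\mathbb{F}_q)$, $S\in O_{2,\Delta}(\mathbb{F}_q)$, acting on $\Lambda$ by $(A\ I^{(\nu)}\ Z)\mapsto(T^tAT\ \ I^{(\nu)}\ \ T^tZS)$. $\Omega\subseteq\mathbb{F}_q^*$ is a fixed subset with $\mathbb{F}_q^*=\Omega\cup(-\Omega)$ and $\Omega\cap(-\Omega)=\emptyset$. Notation: $[X_1,\dots,X_t]$ is the block diagonal matrix with diagonal blocks $X_i$ (blocks of size $0$ omitted; a scalar is a $1\times1$ block; $0$ alone is the $1\times 1$ zero block); $0^{(p)}$, $0^{(p,s)}$ are zero matrices of sizes $p\times p$, $p\times s$; $\mathcal{A}_2=\begin{pmatrix}0&1\\-1&0\end{pmatrix}$, $\mathcal{A}_{2r}=[\mathcal{A}_2,\dots,\mathcal{A}_2]$ ($r$ copies), $\mathcal{A}_0$ empty; $E_i\in\mathbb{F}_q^\nu$ is the $i$-th standard unit column vector and $(U\ \ V)$ denotes the matrix with column blocks $U,V$. *)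

(* Defs.v *)
From mathcomp Require Import all_boot all_order all_algebra.

Set Implicit Arguments.
Unset Strict Implicit.
Unset Printing Implicit Defensive.

Import GRing.Theory.
Local Open Scope ring_scope.

Section Defs.

Variable F : finFieldType.

Definition is_square (x : F) : bool := [exists y : F, y ^+ 2 == x].

Definition mx_of_rows m n (s : seq (seq F)) : 'M[F]_(m, n) :=
  \matrix_(i, j) (nth [::] s i)`_j.

Definition Delta (z : F) : 'M[F]_2 := mx_of_rows 2 2 [:: [:: 1; 0]; [:: 0; - z]].

Definition A2 : 'M[F]_2 := mx_of_rows 2 2 [:: [:: 0; 1]; [:: -1; 0]].

Definition Ymx : 'M[F]_3 :=
  mx_of_rows 3 3 [:: [:: 0; 0; 1]; [:: 0; 0; 1]; [:: -1; -1; 0]].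

Definition Kmx : 'M[F]_(2 + 2) := block_mx 0 1%:M (- 1%:M) 0.

(* A square block together with its size. *)
Definition block := {n : nat & 'M[F]_n}.

Definition blk n (X : 'M[F]_n) : block := Tagged (fun n => 'M[F]_n) X.

(* The block diagonal matrix [X_1, ..., X_t], seen as an nu x nu matrix.  The
   cast conform_mx yields 0 unless the sizes of the blocks add up to nu; they
   do for every use below with indices in the range phi_index_ok. *)
Definition bdiag nu (s : seq block) : 'M[F]_nu :=
  conform_mx 0 (\mxdiag_(i < size s) tagged (nth (blk (0 : 'M_0)) s i)).

(* The blocks of \mathcal{A}_{2r}. *)
Definition A2s (r : nat) : seq block := nseq r (blk A2).

Definition zblk (n : nat) : block := blk (0 : 'M[F]_n).

(* The unit column E_k, with k counted from 1. *)
Definition Ecol nu (k : nat) : 'cV[F]_nu := \col_i (i.+1 == k)%:R.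

Section Space.

Variables (nu : nat) (z : F).

Definition Smx : 'M[F]_(nu + nu + 2) :=
  block_mx (block_mx 0 1%:M 1%:M 0) 0 0 (Delta z).

Definition orthO : {set 'M[F]_(nu + nu + 2)} :=
  [set T | (T \in unitmx) && (T *m Smx *m T^T == Smx)].

(* Subspaces of the space of row vectors are represented by the canonical
   square matrices <<M>>%MS: two matrices have the same row space if and only
   if their canonical matrices are equal (genmxP). *)
Definition subsp m (M : 'M[F]_(m, nu + nu + 2)) : 'M[F]_(nu + nu + 2) :=
  <<M>>%MS.

Definition act (U T : 'M[F]_(nu + nu + 2)) : 'M[F]_(nu + nu + 2) :=
  subsp (U *m T).

Definition P0 := subsp (row_mx (row_mx 1%:M 0) (0 : 'M[F]_(nu, 2))).

Definition P1 := subsp (row_mx (row_mx 0 1%:M) (0 : 'M[F]_(nu, 2))).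

Definition AIZ (A : 'M[F]_nu) (Z : 'M[F]_(nu, 2)) :=
  subsp (row_mx (row_mx A 1%:M) Z).

Definition Lambda : {set 'M[F]_(nu + nu + 2)} :=
  [set AIZ p.1 p.2 | p : 'M[F]_nu * 'M[F]_(nu, 2)
     & p.1 + p.1^T + p.2 *m Delta z *m p.2^T == 0].

Definition G0 : {set 'M[F]_(nu + nu + 2)} := [set T in orthO | act P0 T == P0].

Definition G01 : {set 'M[F]_(nu + nu + 2)} := [set T in G0 | act P1 T == P1].

Definition orbit01 (U : 'M[F]_(nu + nu + 2)) : {set 'M[F]_(nu + nu + 2)} :=
  [set act U T | T in G01].

(* Number of orbits on Lambda of the stabiliser of P1 in G0. *)
Definition rank_G0 : nat := #|[set orbit01 U | U in Lambda]|.

Definition Z1 (a : F) : 'M[F]_(nu, 2) := row_mx (Ecol nu 1) (a *: Ecol nu 1).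

Definition Z2 : 'M[F]_(nu, 2) := row_mx (Ecol nu 1) (Ecol nu 2).

Definition sblk (a : F) : block := blk ((- ((1 - z * a ^+ 2) / 2%:R))%:M : 'M_1).

Definition mhalfDelta : 'M[F]_2 := - (2%:R^-1 *: Delta z).

Definition phi1 (r : nat) :=
  AIZ (bdiag nu (rcons (A2s r) (zblk (nu - 2 * r)))) 0.

Definition phi2 (r : nat) (a : F) :=
  AIZ (bdiag nu (sblk a :: rcons (A2s r) (zblk (nu - 2 * r - 1)))) (Z1 a).

Definition phi3 (r : nat) (a : F) :=
  AIZ (bdiag nu (rcons (A2s r) (zblk (nu - 2 * r)))
       + bdiag nu [:: sblk a; zblk (nu - 1)]) (Z1 a).

Definition phi4 (r : nat) :=
  AIZ (bdiag nu (zblk 1 :: rcons (A2s r) (zblk (nu - 1 - 2 * r)))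
       + bdiag nu [:: blk mhalfDelta; zblk (nu - 2)]) Z2.

Definition phi5 (r : nat) :=
  AIZ (bdiag nu (blk Ymx :: rcons (A2s (r - 1)) (zblk (nu - 1 - 2 * r)))
       + bdiag nu [:: blk mhalfDelta; zblk (nu - 2)]) Z2.

Definition phi6 (r : nat) :=
  AIZ (bdiag nu (blk mhalfDelta :: rcons (A2s r) (zblk (nu - 2 * r - 2)))) Z2.

Definition phi7 (r : nat) (b : F) :=
  AIZ (bdiag nu (blk (b *: A2 + mhalfDelta)
                 :: rcons (A2s (r - 1)) (zblk (nu - 2 * r)))) Z2.

Definition phi8 (r : nat) :=
  AIZ (bdiag nu (blk Kmx :: rcons (A2s (r - 2)) (zblk (nu - 2 * r)))
       + bdiag nu [:: blk mhalfDelta; zblk (nu - 2)]) Z2.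

End Space.

Inductive phi_index : Type :=
| Phi1 of nat
| Phi2 of nat & F
| Phi3 of nat & F
| Phi4 of nat
| Phi5 of nat
| Phi6 of nat
| Phi7 of nat & F
| Phi8 of nat.

Definition phi_index_ok (nu : nat) (Omega : {set F}) (i : phi_index) : bool :=
  match i with
  | Phi1 r => (1 <= r <= nu %/ 2)%N
  | Phi2 r a => (r <= (nu - 1) %/ 2)%N && ((a == 0) || (a == 1))
  | Phi3 r a => (1 <= r <= nu %/ 2)%N && ((a == 0) || (a == 1))
  | Phi4 r => (r <= (nu - 1) %/ 2)%N
  | Phi5 r => (1 <= r <= (nu - 1) %/ 2)%N
  | Phi6 r => (1 <= r <= (nu - 2) %/ 2)%N
  | Phi7 r b => (1 <= r <= nu %/ 2)%N && (b \in Omega)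
  | Phi8 r => (2 <= r <= nu %/ 2)%N
  end.

Definition phi (nu : nat) (z : F) (i : phi_index) : 'M[F]_(nu + nu + 2) :=
  match i with
  | Phi1 r => phi1 nu r
  | Phi2 r a => phi2 nu z r a
  | Phi3 r a => phi3 nu z r a
  | Phi4 r => phi4 nu z r
  | Phi5 r => phi5 nu z r
  | Phi6 r => phi6 nu z r
  | Phi7 r b => phi7 nu z r b
  | Phi8 r => phi8 nu z r
  end.

End Defs.

(* Main.v *)
(**
  Writing [A = B - Z Delta Z^t / 2] turns the points of [Lambda] into pairs
  [(B, Z)] of an alternating [nu x nu] matrix and a [nu x 2] matrix, on which
  [G01] acts by [(Y B Y^t, Y Z S)] with [Y] invertible and [S] in
  [O_2(Delta)].  A Witt type argument shows that, for fixed [S], the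
  [Y]-orbit of [(B, Z)] is determined by the rank of [B], by the linear
  relations among the columns of [Z], in the whole space and modulo the column
  space of [B], and by the alternating form which [B] induces on its column
  space.  As [O_2(Delta)] has two orbits on the lines of the plane, separated
  by the square class of the (anisotropic) norm [x^2 - z y^2], this leaves
  seven kinds of pairs for each rank of [B], three of them with a parameter in
  [{0, 1}] and one with a parameter in [Omega].
*)
From mathcomp Require Import all_boot all_order all_algebra.
From mathcomp Require Import fingroup cyclic.
From mathcomp Require Import zify ring.
Require Import Defs.
Import GRing.Theory.
Local Open Scope ring_scope.
Set Implicit Arguments.
Unset Strict Implicit.
Unset Printing Implicit Defensive.

(** * Alternating forms: congruence, orthogonal splitting and Witt extension *)

Section SkewMatrices.

Variable F : fieldType.
Hypothesis two_neq0 : 2%:R != 0 :> F.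

(** The obstacle is degeneracy: [B] may have a radical, and the columns of [Z] may fall outside its
    column space, so Witt's theorem for nondegenerate forms does not apply as it stands. The remedy
    is to carry witnesses. Rows [x] of the left kernel of [B], dual to columns [U], control the part
    of [Z] outside the column space. Rows [H] with invertible Gram matrix [H B H^t] control the part
    inside; where the relevant vectors are isotropic, hyperbolic partners are added to make this
    matrix invertible. What is left over is a complement that [Z] does not see, and on it the rank
    is the only invariant.

    The plane contributes two facts. The vectors [(1, 0)] and [(1, 1)] have norms [1] and [1 - z];
    since [1 - z] is a non-square they represent the two classes of lines, whence the parameter [a]
    in [{0, 1}]. Isometries of the plane have determinant [1] or [-1], so they can change an
    alternating form on it by a sign only; [Omega] selects one sign. *)

Definition skew n (B : 'M[F]_n) := B^T = - B.

Lemma skew0 n : skew (0 : 'M[F]_n).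
Proof. by rewrite /skew trmx0 oppr0. Qed.

Lemma skew_congr m n (X : 'M_(m, n)) (B : 'M[F]_n) :
  skew B -> skew (X *m B *m X^T).
Proof. by move=> sB; rewrite /skew !trmx_mul trmxK sB mulNmx mulmxN mulmxA. Qed.

Lemma skew_tr_mul m p n (X : 'M_(m, n)) (Y : 'M_(p, n)) (B : 'M[F]_n) :
  skew B -> (X *m B *m Y^T)^T = - (Y *m B *m X^T).
Proof. by move=> sB; rewrite !trmx_mul trmxK sB mulNmx mulmxN mulmxA. Qed.

Lemma skew_diag n (B : 'M[F]_n) i : skew B -> B i i = 0.
Proof.
move=> /matrixP /(_ i i); rewrite !mxE => Bii.
have /eqP : B i i *+ 2 = 0 by rewrite mulr2n {1}Bii addNr.
by rewrite -mulr_natr mulf_eq0 (negPf two_neq0) orbF => /eqP.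
Qed.

Lemma skew_mx1 (B : 'M_1) : skew B -> B = 0.
Proof. by move=> sB; rewrite [B]mx11_scalar skew_diag // raddf0. Qed.

(** Gram matrix of [k] hyperbolic pairs, one isotropic half listed after the other; [k = 1] gives
    [A2] and [k = 2] gives [Kmx]. *)
Definition symp k : 'M[F]_(k + k) := block_mx 0 1%:M (- 1%:M) 0.

Lemma symp_unit k : symp k \in unitmx.
Proof.
suff: symp k *m (- symp k) = 1%:M by case/mulmx1_unit.
rewrite mulmxN mulmx_block !(mulmx0, mul0mx, mulmxN, mulmx1, mul1mx).
by rewrite !(addr0, add0r) opp_block_mx !oppr0 !opprK -scalar_mx_block.
Qed.

Lemma gram_symp n k (B : 'M[F]_n) (E G : 'M_(k, n)) :
    skew B -> E *m B *m E^T = 0 -> E *m B *m G^T = 1%:M -> G *m B *m G^T = 0 ->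
  col_mx E G *m B *m (col_mx E G)^T = symp k.
Proof.
move=> sB EE EG GG; have GE : G *m B *m E^T = - 1%:M.
  by rewrite -[LHS]opprK -skew_tr_mul // EG trmx1.
by rewrite tr_col_mx mul_col_mx mul_col_row EE EG GG GE.
Qed.

Lemma hyperbolic_pair n (B : 'M[F]_n) :
  skew B -> B != 0 -> exists H : 'M_(1 + 1, n), H *m B *m H^T = symp 1.
Proof.
move=> sB /matrix0Pn[i [j Bij]].
have delta (p q : 'I_n) c :
    delta_mx 0 p *m B *m (c *: delta_mx 0 q)^T = (c * B p q)%:M :> 'M_1.
  by rewrite -rowE linearZ -scalemxAr /= trmx_delta -colE [LHS]mx11_scalar !mxE.
exists (col_mx (delta_mx 0 i) ((B i j)^-1 *: delta_mx 0 j)); apply: gram_symp => //.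
- by apply: skew_mx1; apply: skew_congr.
- by rewrite delta mulVf.
- by apply: skew_mx1; apply: skew_congr.
Qed.

(** [Y] is the change of basis. The size [p] is kept apart from [n] because the bases used below are
    stacked from several blocks, whose sizes add up to [n] only propositionally. *)
Lemma congr_of_bases p n (B B' : 'M[F]_n) (X X' : 'M_(p, n)) :
    p = n -> row_free X -> row_free X' ->
    X *m B *m X^T = X' *m B' *m X'^T ->
  exists Y : 'M_n, [/\ Y \in unitmx, Y *m B *m Y^T = B' & X' *m Y = X].
Proof.
move=> pn; subst p; rewrite !row_free_unit => uX uX' eqX.
exists (invmx X' *m X); split.
- by rewrite unitmx_mul unitmx_inv uX'.
- have -> : invmx X' *m X *m B *m (invmx X' *m X)^T =
            invmx X' *m (X *m B *m X^T) *m (invmx X')^T by rewrite trmx_mul !mulmxA.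
  by rewrite eqX !mulmxA mulVmx // mul1mx -mulmxA -trmx_mul mulVmx // trmx1 mulmx1.
- by rewrite mulKVmx.
Qed.

(** [W] is a basis of the left kernel of [row_mx (B *m H^T) U]. The product of [col_mx H x] with
    that matrix is invertible, so the rows of [H] and [x] are independent modulo this kernel, and
    the dimensions add up. *)
Lemma adapted_complement n p a (B : 'M[F]_n) (U : 'M_(n, a)) (x : 'M_(a, n))
    (H : 'M_(p, n)) :
    H *m B *m H^T \in unitmx -> x *m B = 0 -> x *m U = 1%:M -> H *m U = 0 ->
  exists w, exists W : 'M_(w, n),
    [/\ (p + a + w)%N = n, row_free (col_mx (col_mx H x) W),
        W *m B *m H^T = 0 & W *m U = 0].
Proof.
set J := H *m B *m H^T => uJ xB xU HU.
pose M := row_mx (B *m H^T) U; pose L := col_mx H x.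
have LM : L *m M = block_mx J 0 0 1%:M.
  by rewrite mul_col_row !mulmxA xB mul0mx xU HU.
have uLM : L *m M \in unitmx by rewrite LM unitmxE det_ublock det1 mulr1 -unitmxE.
have rM : \rank M = (p + a)%N.
  apply/eqP; rewrite eqn_leq rank_leq_col -{1}(mxrank_unit uLM).
  by rewrite mxrankM_maxr.
pose W := row_base (kermx M).
have WM : W *m M = 0 by apply/sub_kermxP; rewrite eq_row_base.
exists _, W; split.
- by rewrite mxrank_ker rM subnKC // -rM rank_leq_row.
- rewrite -kermx_eq0; set V := kermx (col_mx _ _).
  have VX : V *m col_mx L W = 0 by exact: mulmx_ker.
  rewrite -[V]hsubmxK mul_row_col in VX *.
  have V1 : lsubmx V = 0.
    have: (lsubmx V *m L + rsubmx V *m W) *m M = 0 by rewrite VX mul0mx.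
    rewrite mulmxDl -[_ *m W *m M]mulmxA WM mulmx0 addr0 -mulmxA.
    move=> /(congr1 (mulmx^~ (invmx (L *m M)))).
    by rewrite mulmxK // mul0mx.
  rewrite V1 mul0mx add0r in VX *.
  have /row_free_inj iW : row_free W by exact: row_base_free.
  suff -> : rsubmx V = 0 by rewrite row_mx0.
  by apply: iW; rewrite VX mul0mx.
- by have := congr1 lsubmx WM; rewrite mul_mx_row row_mxKl raddf0 mulmxA.
- by have := congr1 rsubmx WM; rewrite mul_mx_row row_mxKr raddf0.
Qed.

Lemma gram_adapted n p a w (B : 'M[F]_n) (x : 'M_(a, n)) (H : 'M_(p, n))
    (W : 'M_(w, n)) :
    skew B -> x *m B = 0 -> W *m B *m H^T = 0 ->
  col_mx (col_mx H x) W *m B *m (col_mx (col_mx H x) W)^T =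
  block_mx (block_mx (H *m B *m H^T) 0 0 0) 0 0 (W *m B *m W^T).
Proof.
move=> sB xB WBH; have xT (k : nat) (V : 'M_(k, n)) : V *m B *m x^T = 0.
  by apply: trmx_inj; rewrite skew_tr_mul // xB mul0mx oppr0 trmx0.
have HBW : H *m B *m W^T = 0.
  by apply: trmx_inj; rewrite skew_tr_mul // WBH oppr0 trmx0.
rewrite !tr_col_mx [X in X *m _]mul_col_mx [X in col_mx X _]mul_col_mx xB.
rewrite !mul_col_row mul_mx_row mul_col_mx !mul0mx.
by rewrite !xT HBW WBH row_mx0 col_mx0.
Qed.

Lemma rank_gram n p a w (B : 'M[F]_n) (x : 'M_(a, n)) (H : 'M_(p, n))
    (W : 'M_(w, n)) :
    skew B -> x *m B = 0 -> W *m B *m H^T = 0 -> H *m B *m H^T \in unitmx ->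
    (p + a + w)%N = n -> row_free (col_mx (col_mx H x) W) ->
  \rank B = (p + \rank (W *m B *m W^T))%N.
Proof.
move=> sB xB WBH uJ en fX; rewrite -[X in (X + _)%N](mxrank_unit uJ).
have := gram_adapted sB xB WBH; subst n; set X := col_mx _ _ in fX * => /(congr1 mxrank).
rewrite !rank_diag_block_mx mxrank0 addn0 => <-.
rewrite row_free_unit in fX.
by rewrite mxrankMfree ?row_free_unit ?unitmx_tr // eqmxMfull // row_full_unit.
Qed.

(** Once [W] is replaced by [Q *m W], both bases have the same block diagonal Gram matrix, and the
    change of basis is the required congruence. *)
Lemma congr_of_complements n p a w (B B' : 'M[F]_n) (x x' : 'M_(a, n))
    (H H' : 'M_(p, n)) (W W' : 'M_(w, n)) (Q : 'M_w) :
    skew B -> skew B' -> x *m B = 0 -> x' *m B' = 0 ->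
    H *m B *m H^T = H' *m B' *m H'^T ->
    W *m B *m H^T = 0 -> W' *m B' *m H'^T = 0 ->
    (p + a + w)%N = n -> row_free (col_mx (col_mx H x) W) ->
    row_free (col_mx (col_mx H' x') W') ->
    Q \in unitmx -> Q *m (W *m B *m W^T) *m Q^T = W' *m B' *m W'^T ->
  exists Y : 'M_n, [/\ Y \in unitmx, Y *m B *m Y^T = B', H' *m Y = H,
    x' *m Y = x & W' *m Y = Q *m W].
Proof.
move=> sB sB' xB xB' eqJ WH WH' en fX fX' uQ eqQ.
have fQX : row_free (col_mx (col_mx H x) (Q *m W)).
  have -> : col_mx (col_mx H x) (Q *m W) =
            block_mx 1%:M 0 0 Q *m col_mx (col_mx H x) W.
    by rewrite mul_block_col !mul0mx mul1mx addr0 add0r.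
  subst n; rewrite !row_free_unit in fX *.
  by rewrite unitmx_mul fX unitmxE det_ublock det1 mul1r -unitmxE uQ.
have [|Y [uY YB XY]] := @congr_of_bases _ _ B B' _ _ en fQX fX'.
  rewrite !gram_adapted //; last by rewrite -!mulmxA (mulmxA W) WH mulmx0.
  by rewrite eqJ -eqQ trmx_mul !mulmxA.
exists Y; move: XY; rewrite !mul_col_mx => /eq_col_mx[/eq_col_mx[-> ->] ->].
by split.
Qed.

Lemma hyperbolic_split n (B : 'M[F]_n) : skew B -> B != 0 ->
  exists H : 'M_(1 + 1, n), exists w, exists W : 'M_(w, n),
  [/\ H *m B *m H^T = symp 1, (1 + 1 + 0 + w)%N = n,
      row_free (col_mx (col_mx H (0 : 'M_(0, n))) W), W *m B *m H^T = 0 &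
      \rank B = (2 + \rank (W *m B *m W^T))%N].
Proof.
move=> sB B_neq0; have [H HB] := hyperbolic_pair sB B_neq0.
have uH : H *m B *m H^T \in unitmx by rewrite HB symp_unit.
have xB : (0 : 'M_(0, n)) *m B = 0 by rewrite mul0mx.
have [||w [W [en fX WH _]]] := @adapted_complement n _ 0 B 0 0 H uH xB.
- by rewrite [RHS]flatmx0 [LHS]flatmx0.
- exact: mulmx0.
by exists H, w, W; split=> //; exact: rank_gram sB xB WH uH en fX.
Qed.

(** Induction on the size: a hyperbolic plane is split off both forms, and the Gram matrices of the
    complements still have equal rank. *)
Lemma skew_congruence n (B B' : 'M[F]_n) :
    skew B -> skew B' -> \rank B = \rank B' ->
  exists2 Y : 'M_n, Y \in unitmx & Y *m B *m Y^T = B'.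
Proof.
elim/ltn_ind: n B B' => n IH B B' sB sB' rBB'.
have [B0 | B_neq0] := eqVneq B 0.
  exists 1%:M; rewrite ?unitmx1 // B0 mulmx0 mul0mx.
  by apply/esym/eqP; rewrite -mxrank_eq0 -rBB' B0 mxrank0.
have B'_neq0 : B' != 0 by rewrite -mxrank_eq0 -rBB' mxrank_eq0.
have [H [w [W [HB en fX WH rW]]]] := hyperbolic_split sB B_neq0.
have [H' [w' [W' [HB' en' fX' WH' rW']]]] := hyperbolic_split sB' B'_neq0.
have ew : w' = w by apply/eqP; rewrite -(eqn_add2l (1 + 1 + 0)) en en'.
subst w'.
have w_lt_n : (w < n)%N by rewrite -en !addSn ltnS leqnSn.
have rG : \rank (W *m B *m W^T) = \rank (W' *m B' *m W'^T).
  by apply: (@addnI 2); rewrite -rW -rW'.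
have [Q uQ eqQ] := IH w w_lt_n _ _ (skew_congr W sB) (skew_congr W' sB') rG.
have [|||Y [uY YB _ _ _]] :=
  congr_of_complements sB sB' _ _ _ WH WH' en fX fX' uQ eqQ; rewrite ?mul0mx //.
- by rewrite HB HB'.
by exists Y.
Qed.

Lemma skew_rank_even n (B : 'M[F]_n) : skew B -> ~~ odd (\rank B).
Proof.
elim/ltn_ind: n B => n IH B sB.
have [-> | B_neq0] := eqVneq B 0; first by rewrite mxrank0.
have [H [w [W [_ en _ _ ->]]]] := hyperbolic_split sB B_neq0.
rewrite oddD /=; apply: IH; last exact: skew_congr.
by rewrite -en !addSn ltnS leqnSn.
Qed.

(** The rows of [H], of [x] and of a complement on which [U] and [B *m H^T] vanish form a basis, and
    likewise on the primed side. Carrying one basis to the other gives [Y]; the equation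
    [Y *m U = U'] is then tested row by row against that basis. *)
Lemma skew_witt n p a (B B' : 'M[F]_n) (U U' : 'M_(n, a)) (x x' : 'M_(a, n))
    (H H' : 'M_(p, n)) :
    skew B -> skew B' -> \rank B = \rank B' ->
    x *m B = 0 -> x *m U = 1%:M -> x' *m B' = 0 -> x' *m U' = 1%:M ->
    H *m B *m H^T = H' *m B' *m H'^T -> H *m B *m H^T \in unitmx ->
  exists Y : 'M_n, [/\ Y \in unitmx, Y *m B *m Y^T = B', Y *m U = U' &
    Y *m (B *m H^T) = B' *m H'^T].
Proof.
(* Subtracting [H U x] from [H] makes [H U = 0] without changing [H B]. *)
suff core (K K' : 'M_(p, n)) : skew B -> skew B' -> \rank B = \rank B' ->
    x *m B = 0 -> x *m U = 1%:M -> x' *m B' = 0 -> x' *m U' = 1%:M ->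
    K *m B *m K^T = K' *m B' *m K'^T -> K *m B *m K^T \in unitmx ->
    K *m U = 0 -> K' *m U' = 0 ->
  exists Y : 'M_n, [/\ Y \in unitmx, Y *m B *m Y^T = B', Y *m U = U' &
    Y *m (B *m K^T) = B' *m K'^T].
  move=> sB sB' rB xB xU xB' xU'.
  have adj (C : 'M_n) (V : 'M_(n, a)) (y : 'M_(a, n)) (K : 'M_(p, n)) :
      skew C -> y *m C = 0 -> y *m V = 1%:M ->
    exists L : 'M_(p, n),
      [/\ L *m C = K *m C, C *m L^T = C *m K^T & L *m V = 0].
    move=> sC yC yV; exists (K - K *m V *m y).
    have KC : (K - K *m V *m y) *m C = K *m C.
      by rewrite mulmxBl -[X in _ - X]mulmxA yC mulmx0 subr0.
    split=> //; last by rewrite mulmxBl -[X in _ - X]mulmxA yV mulmx1 subrr.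
    by apply: trmx_inj; rewrite !trmx_mul !trmxK sC !mulmxN KC.
  have [K [KB BK KU]] := adj B U x H sB xB xU.
  have [K' [KB' BK' KU']] := adj B' U' x' H' sB' xB' xU'.
  have := core K K' sB sB' rB xB xU xB' xU'.
  by rewrite KB KB' BK BK' -!mulmxA BK BK' => + eqJ uJ; apply.
move=> sB sB' rB xB xU xB' xU' eqJ uJ KU KU'.
have uJ' : K' *m B' *m K'^T \in unitmx by rewrite -eqJ.
have [w [W [en fX WH WU]]] := adapted_complement uJ xB xU KU.
have [w' [W' [en' fX' WH' WU']]] := adapted_complement uJ' xB' xU' KU'.
have ew : w' = w by apply/eqP; rewrite -(eqn_add2l (p + a)) en en'.
subst w'.
have rG : \rank (W *m B *m W^T) = \rank (W' *m B' *m W'^T).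
  apply: (@addnI p); rewrite -(rank_gram sB xB WH uJ en fX) rB.
  exact: rank_gram sB' xB' WH' uJ' en' fX'.
have [Q uQ eqQ] := skew_congruence (skew_congr W sB) (skew_congr W' sB') rG.
have [Y [uY YB HY xY WY]] :=
  congr_of_complements sB sB' xB xB' eqJ WH WH' en fX fX' uQ eqQ.
exists Y; split=> //; last by rewrite -HY trmx_mul !mulmxA YB.
have : col_mx (col_mx K' x') W' *m (Y *m U) = col_mx (col_mx K' x') W' *m U'.
  by rewrite !mul_col_mx !mulmxA HY xY WY KU KU' xU xU' -mulmxA WU WU' mulmx0.
move: fX'; set X' := col_mx _ _ => fX' eqX.
have : row_full X' by rewrite /row_full (eqP fX') en.
by move=> /row_full_inj; apply.
Qed.

End SkewMatrices.

(** * Normal forms of a pair [(B, Z)] for the action of [Y], and their invariants *)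

Section Shapes.

Variable F : fieldType.
Hypothesis two_neq0 : 2%:R != 0 :> F.

(** The witness [x] makes the columns of [U] independent modulo the column space of [B]. The columns
    of [B *m H^T] lie inside it and have Gram matrix [J] for the form that sends [B u], [B v] to
    [u^t B v]. In these vectors [Z] has the coordinates [C] and [D]. *)
Definition shape n k a p (B : 'M[F]_n) (Z : 'M[F]_(n, k))
    (J : 'M[F]_p) (C : 'M[F]_(a, k)) (D : 'M[F]_(p, k)) : Prop :=
  exists U : 'M_(n, a), exists x : 'M_(a, n), exists H : 'M_(p, n),
  [/\ x *m B = 0, x *m U = 1%:M, H *m B *m H^T = J
    & Z = U *m C + B *m H^T *m D].

Lemma shape_equiv n k a p (B B' : 'M_n) (Z Z' : 'M_(n, k)) (J : 'M_p)
    (C : 'M_(a, k)) (D : 'M_(p, k)) :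
    skew B -> skew B' -> J \in unitmx -> \rank B = \rank B' ->
    shape B Z J C D -> shape B' Z' J C D ->
  exists Y : 'M_n, [/\ Y \in unitmx, Y *m B *m Y^T = B' & Y *m Z = Z'].
Proof.
move=> sB sB' uJ rB [U [x [H [xB xU HJ ->]]]] [U' [x' [H' [xB' xU' HJ' ->]]]].
have [||Y [uY YB YU YH]] := skew_witt two_neq0 sB sB' rB xB xU xB' xU' (H := H) (H' := H').
- by rewrite HJ HJ'.
- by rewrite HJ.
by exists Y; split=> //; rewrite mulmxDr (mulmxA Y U) YU (mulmxA Y (B *m H^T)) YH.
Qed.

(** Source of the ranges of [r] in the list: [J] is a Gram matrix of [B], and [x] consists of [a]
    independent rows of the left kernel. *)
Lemma shape_bounds n k a p (B : 'M_n) (Z : 'M_(n, k)) (J : 'M_p)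
    (C : 'M_(a, k)) (D : 'M_(p, k)) :
    skew B -> J \in unitmx -> shape B Z J C D ->
  (p <= \rank B /\ \rank B + a <= n)%N.
Proof.
move=> sB uJ [U [x [H [xB xU HJ _]]]]; split.
  rewrite -(mxrank_unit uJ) -HJ.
  by apply: leq_trans (mxrankM_maxl _ _) _; apply: mxrankM_maxr.
have xx : (x <= kermx B)%MS by apply/sub_kermxP.
have <- : \rank x = a.
  by apply/eqP/row_freeP; exists U.
rewrite -leq_subRL ?rank_leq_row //.
by have := mxrankS xx; rewrite mxrank_ker => /leq_trans; apply.
Qed.

Lemma shape_rank n k a p (B : 'M_n) (Z : 'M_(n, k)) (J : 'M_p)
    (C : 'M_(a, k)) (D : 'M_(p, k)) :
  shape B Z J C D -> \rank (kermx B *m Z) = \rank C.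
Proof.
move=> [U [x [H [xB xU _ ->]]]]; rewrite mulmxDr !mulmxA mulmx_ker !mul0mx addr0.
apply/eqP; rewrite eqn_leq mxrankM_maxr /=.
have /submxP[y xy] : (x <= kermx B)%MS by apply/sub_kermxP.
by rewrite -[C in (\rank C <= _)%N]mul1mx -xU xy -!mulmxA mxrankM_maxr.
Qed.

Lemma shape_act n k a p (B Y : 'M_n) (Z : 'M_(n, k)) (J : 'M_p)
    (C : 'M_(a, k)) (D : 'M_(p, k)) (S : 'M_k) :
    Y \in unitmx -> shape B Z J C D ->
  shape (Y *m B *m Y^T) (Y *m Z *m S) J (C *m S) (D *m S).
Proof.
move=> uY [U [x [H [xB xU HJ ->]]]].
exists (Y *m U), (x *m invmx Y), (H *m invmx Y); split.
- by rewrite !mulmxA mulmxKV // xB mul0mx.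
- by rewrite !mulmxA mulmxKV.
- rewrite !mulmxA mulmxKV // trmx_mul !mulmxA -(mulmxA _ Y^T) -trmx_mul.
  by rewrite mulVmx // trmx1 mulmx1.
- rewrite trmx_mul !mulmxA -(mulmxA _ Y^T) -trmx_mul mulVmx // trmx1 mulmx1.
  by rewrite mulmxDr mulmxDl !mulmxA.
Qed.

Lemma shape_coeff_sub n k a p a' p' (B : 'M_n) (Z : 'M_(n, k))
    (J : 'M_p) (C : 'M_(a, k)) (D : 'M_(p, k))
    (J' : 'M_p') (C' : 'M_(a', k)) (D' : 'M_(p', k)) :
  shape B Z J C D -> shape B Z J' C' D' -> (C <= C')%MS.
Proof.
move=> [U [x [H [xB xU _ ->]]]] [U' [x' [H' [_ _ _ eqZ]]]]; apply/submxP.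
exists (x *m U'); move: (congr1 (mulmx x) eqZ).
by rewrite !mulmxDr !mulmxA xB !mul0mx !addr0 xU mul1mx.
Qed.

(** Without [C] one has [Z = B W] for [W = H^T D], and [W^t B W = D^t J D] depends on [B W] alone
    because [B] is skew. *)
Lemma shape_form n k p p' (B : 'M_n) (Z : 'M_(n, k))
    (J : 'M_p) (C : 'M_(0, k)) (D : 'M_(p, k))
    (J' : 'M_p') (C' : 'M_(0, k)) (D' : 'M_(p', k)) :
    skew B -> shape B Z J C D -> shape B Z J' C' D' ->
  D^T *m J *m D = D'^T *m J' *m D'.
Proof.
move=> sB [U [x [H [_ _ <- ZD]]]] [U' [x' [H' [_ _ <- ZD']]]].
rewrite flatmx0 mulmx0 add0r in ZD; rewrite [C']flatmx0 mulmx0 add0r in ZD'.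
have eqBD : B *m (H^T *m D) = B *m (H'^T *m D') by rewrite !mulmxA -ZD.
have eqDB : (H^T *m D)^T *m B = (H'^T *m D')^T *m B.
  by move: (congr1 trmx eqBD); rewrite !(trmx_mul B) sB !mulmxN => /oppr_inj.
have -> : D^T *m (H *m B *m H^T) *m D = (H^T *m D)^T *m B *m (H^T *m D).
  by rewrite trmx_mul trmxK !mulmxA.
by rewrite eqDB -mulmxA eqBD trmx_mul trmxK !mulmxA.
Qed.

Lemma shape_row_space n k a p (B : 'M_n) (Z : 'M_(n, k)) (J : 'M_p)
    (C : 'M_(a, k)) (D : 'M_(p, k)) :
  J \in unitmx -> shape B Z J C D -> (Z :=: col_mx C D)%MS.
Proof.
move=> uJ [U [x [H [xB xU HJ ->]]]]; apply/eqmxP/andP; split; apply/submxP.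
  by exists (row_mx U (B *m H^T)); rewrite mul_row_col.
(* [L] is the product of [col_mx x H] and [row_mx U (B *m H^T)]. *)
pose L : 'M_(a + p) := block_mx 1%:M 0 (H *m U) J.
have uL : L \in unitmx by rewrite unitmxE det_lblock det1 mul1r -unitmxE.
exists (invmx L *m col_mx x H); rewrite -[RHS]mulmxA.
suff -> : col_mx x H *m (U *m C + B *m H^T *m D) = L *m col_mx C D by rewrite mulKmx.
rewrite mul_block_col mul_col_mx !mulmxDr !mulmxA xB xU HJ !mul0mx.
by rewrite !addr0 !mul1mx.
Qed.

Lemma skew_image n m (B : 'M[F]_n) (Y : 'M_(n, m)) :
  skew B -> kermx B *m Y = 0 -> exists W : 'M_(n, m), Y = B *m W.
Proof.
move=> sB kY; have /submxP[D eD] : (Y^T <= B)%MS.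
  rewrite submxE; apply/eqP/trmx_inj; rewrite trmx_mul trmxK trmx0.
  have /sub_kermxP/submxP[w ->] : (cokermx B)^T *m B = 0.
    by apply: trmx_inj; rewrite trmx_mul trmxK sB mulNmx mulmx_coker oppr0 trmx0.
  by rewrite -mulmxA kY mulmx0.
by exists (- D^T); rewrite mulmxN -mulNmx -sB -trmx_mul -eD trmxK.
Qed.

(** Trailing blocks on which [Z] vanishes leave the shape alone; all witnesses are padded by
    zeros. *)
Lemma shape_block n m k a p (B : 'M_n) (B1 : 'M_m) (Z : 'M_(n, k)) (J : 'M_p)
    (C : 'M_(a, k)) (D : 'M_(p, k)) :
  shape B Z J C D -> shape (block_mx B 0 0 B1) (col_mx Z 0) J C D.
Proof.
move=> [U [x [H [xB xU HJ ->]]]].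
exists (col_mx U 0), (row_mx x 0), (row_mx H 0); split.
- by rewrite mul_row_block !mul0mx !mulmx0 xB !addr0 row_mx0.
- by rewrite mul_row_col xU mul0mx addr0.
- rewrite mul_row_block tr_row_mx mul_row_col !mul0mx !mulmx0 !addr0.
  by rewrite HJ trmx0 mulmx0 addr0.
- rewrite tr_row_mx mul_block_col !mul0mx trmx0 !mulmx0 !addr0 !mul_col_mx.
  by rewrite !mul0mx add_col_mx addr0.
Qed.

End Shapes.

(** * The norm form [x^2 - z y^2] and its isometries *)

Section BinaryForm.

Variables (F : finFieldType) (z : F).

Lemma is_square_mul (x y : F) :
  ~~ is_square x -> ~~ is_square y -> is_square (x * y).
Proof.
have sq0 : is_square (0 : F) by apply/existsP; exists 0; rewrite expr0n.
have sq (t : F) : ~~ is_square t -> t \is a GRing.unit.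
  by rewrite unitfE; apply: contraNneq => ->.
move=> nx ny; have [ux uy] := (sq x nx, sq y ny).
have /cyclicP[g defG] := field_unit_group_cyclic [group of [set: {unit F}]].
(* A non-square is an odd power of a generator of the cyclic group of units. *)
have pow (t : F) (ut : t \is a GRing.unit) : ~~ is_square t ->
    exists k, t = val g ^+ (k.*2.+1).
  have /cycleP[m tm] : FinRing.Unit ut \in <[g]>%g by rewrite -defG inE.
  have {}tm : t = val g ^+ m by rewrite -FinRing.val_unitX -tm.
  case: (boolP (odd m)) => [om | em nt].
    by exists m./2; rewrite {1}tm -{1}(odd_double_half m) om.
  case/existsP: nt; exists (val g ^+ m./2).
  by rewrite tm -exprM muln2 -{2}(odd_double_half m) (negPf em).
have [[i ->] [j ->]] := (pow x ux nx, pow y uy ny).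
apply/existsP; exists (val g ^+ (i + j).+1).
by rewrite -exprM -exprD muln2 doubleS doubleD addSn addnS.
Qed.

Lemma mx2P (R : Type) (M N : 'M[R]_2) :
  M 0 0 = N 0 0 -> M 0 1 = N 0 1 -> M 1 0 = N 1 0 -> M 1 1 = N 1 1 -> M = N.
Proof.
move=> h00 h01 h10 h11; apply/matrixP.
have ord2 (i : 'I_2) : i = 0 \/ i = 1.
  by case: i => [[|[|//]] lti]; [left | right]; apply: val_inj.
by move=> i j; case: (ord2 i) => ->; case: (ord2 j) => ->.
Qed.

Lemma det_mx22 (R : comNzRingType) (M : 'M[R]_2) :
  \det M = M 0 0 * M 1 1 - M 0 1 * M 1 0.
Proof.
rewrite (expand_det_row _ 0) !big_ord_recl big_ord0 /cofactor !det_mx11 !mxE /=.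
rewrite expr0 expr1 mul1r addr0 mulN1r mulrN.
by congr (_ * M _ _ - M _ _ * M _ _); apply: val_inj.
Qed.

Definition isO2 (S : 'M[F]_2) := S *m Delta z *m S^T == Delta z.

Definition row1 (a : F) : 'rV[F]_2 := mx_of_rows 1 2 [:: [:: 1; a]].

Lemma isO2_det (S : 'M[F]_2) : 
  z != 0 -> isO2 S -> \det S ^+ 2 = 1.
Proof.
move=> z0 /eqP /(congr1 determinant); rewrite !det_mulmx det_tr => eqd.
have dD : \det (Delta z) != 0.
  by rewrite det_mx22 !mxE /= mul1r mulr0 subr0 oppr_eq0.
by apply: (mulIf dD); rewrite mul1r -[RHS]eqd; ring.
Qed.

Lemma isO2_unit (S : 'M[F]_2) : z != 0 -> isO2 S -> S \in unitmx.
Proof.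
move=> z0 /isO2_det -/(_ z0) dS; rewrite unitmxE unitfE.
by apply: contra_eq_neq dS => ->; rewrite expr0n eq_sym oner_eq0.
Qed.

Lemma isO2_mul (S T : 'M[F]_2) : isO2 S -> isO2 T -> isO2 (S *m T).
Proof.
move=> /eqP oS /eqP oT; apply/eqP.
by rewrite trmx_mul mulmxA -(mulmxA S T) -(mulmxA S) oT.
Qed.

Lemma isO2_inv (S : 'M[F]_2) : z != 0 -> isO2 S -> isO2 (invmx S).
Proof.
move=> z0 oS; have uS := isO2_unit z0 oS; apply/eqP.
rewrite -{1}(eqP oS) !mulmxA mulVmx // mul1mx -mulmxA -trmx_mul mulVmx //.
by rewrite trmx1 mulmx1.
Qed.

(** Multiplication by [b.1 + b.2 sqrt z], where the row [(x, y)] stands for [x + y sqrt z]; it is an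
    isometry when this element has norm one. *)
Definition rot (b : F * F) : 'M[F]_2 :=
  mx_of_rows 2 2 [:: [:: b.1; b.2]; [:: z * b.2; b.1]].

Lemma rot_O2 b : b.1 ^+ 2 - z * b.2 ^+ 2 = 1 -> isO2 (rot b).
Proof.
move=> nb; have e1 : b.1 ^+ 2 = 1 + z * b.2 ^+ 2 by rewrite -nb subrK.
apply/eqP/mx2P; rewrite !mxE !big_ord_recl big_ord0 !mxE !big_ord_recl !big_ord0 !mxE /=.
all: ring: e1.
Qed.

Hypotheses (z_nsq : ~~ is_square z) (z1_nsq : ~~ is_square (1 - z)).

Lemma z_neq0 : z != 0.
Proof.
by apply: contraNneq z_nsq => ->; apply/existsP; exists 0; rewrite expr0n.
Qed.

Lemma rotate (v : 'rV[F]_2) : v != 0 ->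
  exists S l a, [/\ isO2 S, l != 0, (a == 0) || (a == 1) & v *m S = l *: row1 a].
Proof.
move=> v0; pose N := v 0 0 ^+ 2 - z * v 0 1 ^+ 2.
have N0 : N != 0.
  apply: contraNneq v0 => /eqP; rewrite subr_eq0 => /eqP eN.
  have v1 : v 0 1 = 0.
    apply: contraNeq z_nsq => v1; apply/existsP; exists (v 0 0 / v 0 1).
    by rewrite expr_div_n eN mulfK // expf_neq0.
  have v00 : v 0 0 = 0.
    by move/eqP: eN; rewrite v1 expr0n mulr0 expf_eq0 => /eqP.
  apply/eqP/rowP => i; rewrite mxE.
  by case: i => [[|[|//]] lti]; [rewrite -[RHS]v00 | rewrite -[RHS]v1];
    congr (v _ _); apply: val_inj.
(* The norm of [v] is a square times [1] or times [1 - z], since the product of two non-squares is a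
   square. *)
have [l [a [aP eN]]] : exists l a,
    ((a == 0) || (a == 1)) /\ N = l ^+ 2 * (1 - z * a ^+ 2).
  have [/existsP[l /eqP Nl] | nN] := boolP (is_square N).
    by exists l, 0; rewrite eqxx Nl; split=> //; ring.
  have /existsP[s /eqP Ns] := is_square_mul nN z1_nsq.
  have z1 : 1 - z != 0.
    by apply: contraNneq z1_nsq => ->; apply/existsP; exists 0; rewrite expr0n.
  exists (s / (1 - z)), 1; rewrite eqxx orbT; split=> //.
  by rewrite expr_div_n Ns; field.
have l0 : l != 0 by apply: contraNneq N0 => l0; rewrite eN l0 expr0n mul0r.
(* This is multiplication by the quotient of [l (1 + a sqrt z)] by [v], written with the conjugate
   of [v] over [N]; numerator and denominator both have norm [N]. *)
exists (rot (l * (v 0 0 - z * a * v 0 1) / N, l * (a * v 0 0 - v 0 1) / N)), l, a.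
split=> //.
  have nN : l ^+ 2 * ((v 0 0 - z * a * v 0 1) ^+ 2
                      - z * (a * v 0 0 - v 0 1) ^+ 2) = N * N.
    by rewrite {1}eN /N; ring.
  apply: rot_O2 => /=; apply: (mulIf (mulf_neq0 N0 N0)).
  by rewrite mul1r -[RHS]nN; field.
apply/rowP => i; rewrite !mxE !big_ord_recl big_ord0 !mxE /=.
have -> : lift ord0 ord0 = 1 :> 'I_2 by apply: val_inj.
case: i => [[|[|//]] lti] /=; apply: (mulfI N0); rewrite /N; field; exact: N0.
Qed.

End BinaryForm.

(** * The group [G01] and its orbits in the coordinates [(B, Z)] *)

Section Orbits.

Variables (F : finFieldType) (n : nat) (z : F).
Hypothesis z_neq0 : z != 0.

Local Notation mxV := 'M[F]_(n + n + 2).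

Lemma act_subsp m (M : 'M_(m, n + n + 2)) (T : mxV) :
  act (subsp M) T = subsp (M *m T).
Proof. exact/eq_genmx/eqmxMr/genmxE. Qed.

Lemma subsp_mull m (Y : 'M_m) (M : 'M[F]_(m, n + n + 2)) :
  Y \in unitmx -> subsp (Y *m M) = subsp M.
Proof. by move=> uY; apply/eq_genmx/eqmxMfull; rewrite row_full_unit. Qed.

Lemma AIZ_inj (A A' : 'M[F]_n) (Z Z' : 'M_(n, 2)) :
  AIZ A Z = AIZ A' Z' -> A = A' /\ Z = Z'.
Proof.
move=> /genmxP/andP[/submxP[D] + _].
rewrite !mul_mx_row mulmx1 => /eq_row_mx[/eq_row_mx[-> <-] ->].
by rewrite !mul1mx.
Qed.

Lemma sub_P0 m (M : 'M[F]_(m, n)) (N : 'M_(m, n)) (X : 'M_(m, 2)) :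
  (row_mx (row_mx M N) X <= P0 F n)%MS -> N = 0 /\ X = 0.
Proof.
rewrite genmxE => /submxP[D]; rewrite !mul_mx_row !mulmx0.
by move=> /eq_row_mx[/eq_row_mx[]].
Qed.

Lemma sub_P1 m (M : 'M[F]_(m, n)) (N : 'M_(m, n)) (X : 'M_(m, 2)) :
  (row_mx (row_mx M N) X <= P1 F n)%MS -> M = 0 /\ X = 0.
Proof.
rewrite genmxE => /submxP[D]; rewrite !mul_mx_row !mulmx0.
by move=> /eq_row_mx[/eq_row_mx[]].
Qed.

(** This is [[T, (T^t)^-1, S]] with [T = Y^t], so that [Y] multiplies [A] and [Z] from the left. *)
Definition diagG (Y : 'M[F]_n) (S : 'M_2) : mxV :=
  block_mx (block_mx Y^T 0 0 (invmx Y)) 0 0 S.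

Lemma AIZ_diagG (Y : 'M[F]_n) (S : 'M_2) (A : 'M_n) (Z : 'M_(n, 2)) :
    Y \in unitmx ->
  act (AIZ A Z) (diagG Y S) = AIZ (Y *m A *m Y^T) (Y *m Z *m S).
Proof.
move=> uY; rewrite act_subsp -(subsp_mull _ uY); congr subsp.
rewrite !mul_row_block !mulmx0 !(addr0, add0r) mul1mx !mul_mx_row mulmxV //.
by rewrite !mulmxA.
Qed.

Lemma diagG_in (Y : 'M[F]_n) (S : 'M_2) :
  Y \in unitmx -> isO2 z S -> diagG Y S \in G01 n z.
Proof.
move=> uY oS; have uS := isO2_unit z_neq0 oS.
rewrite !inE; apply/andP; split; first apply/andP; first split.
- apply/andP; split.
    rewrite unitmxE !det_ublock det_tr det_inv.
    by rewrite unitrM -!unitmxE uS unitrM unitrV -unitmxE uY.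
  apply/eqP; rewrite /diagG /Smx !tr_block_mx !trmx0 trmxK !mulmx_block.
  rewrite !(mulmx0, mul0mx, addr0, add0r, mulmx1) (eqP oS).
  rewrite !mulmx_block !(mulmx0, mul0mx, addr0, add0r).
  by rewrite -trmx_mul mulVmx // trmx1.
- rewrite act_subsp !mul_row_block !(mulmx0, mul0mx, addr0, add0r) mul1mx.
  have -> : row_mx (row_mx Y^T (0 : 'M_n)) (0 : 'M_(n, 2)) =
            Y^T *m row_mx (row_mx 1%:M 0) 0.
    by rewrite !mul_mx_row mulmx1 !mulmx0.
  by rewrite subsp_mull ?unitmx_tr.
- rewrite act_subsp !mul_row_block !(mulmx0, mul0mx, addr0, add0r) mul1mx.
  have -> : row_mx (row_mx (0 : 'M_n) (invmx Y)) (0 : 'M_(n, 2)) =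
            invmx Y *m row_mx (row_mx 0 1%:M) 0.
    by rewrite !mul_mx_row mulmx1 !mulmx0.
  by rewrite subsp_mull ?unitmx_inv.
Qed.

(** Stability of [P0] and [P1] kills the off-diagonal blocks of the first two block rows. The
    isometry equation makes the first two diagonal blocks invertible, and this forces the
    off-diagonal blocks of the last block row to vanish as well. *)
Lemma G01_diagG (T : mxV) : T \in G01 n z ->
  exists Y S, [/\ Y \in unitmx, isO2 z S & T = diagG Y S].
Proof.
rewrite !inE -!andbA => /and4P[uT /eqP TST /eqP T0 /eqP T1].
rewrite -[T]submxK -[ulsubmx T]submxK in uT TST T0 T1 *.
move: (ulsubmx (ulsubmx T)) (ursubmx (ulsubmx T)) (dlsubmx (ulsubmx T))
  (drsubmx (ulsubmx T)) (drsubmx T) uT TST T0 T1 => T11 T12 T21 T22 S.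
rewrite -[ursubmx T]vsubmxK -[dlsubmx T]hsubmxK.
move: (usubmx (ursubmx T)) (dsubmx (ursubmx T)) (lsubmx (dlsubmx T))
  (rsubmx (dlsubmx T)) => T13 T23 T31 T32 uT TST T0 T1.
have [e12 e13] : T12 = 0 /\ T13 = 0.
  apply: (@sub_P0 _ T11); rewrite -{}T0 act_subsp genmxE mul_row_block.
  by rewrite mul_row_block mul_row_col !mul0mx !mul1mx !addr0.
have [e21 e23] : T21 = 0 /\ T23 = 0.
  apply: (@sub_P1 _ _ T22); rewrite -{}T1 act_subsp genmxE mul_row_block.
  by rewrite mul_row_block mul_row_col !mul0mx !mul1mx !addr0 !add0r.
subst T12 T13 T21 T23.
move: TST; rewrite col_mx0 !tr_block_mx !trmx0 tr_row_mx /Smx !mulmx_block.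
rewrite !(mulmx0, mul0mx, addr0, add0r, mulmx1) !mul_row_block.
rewrite !(mulmx0, mul0mx, addr0, add0r, mulmx1) !mul_row_col.
rewrite !mul_block_col !(mulmx0, mul0mx, addr0, add0r, mulmx1).
move=> /eq_block_mx[+ e2 e3 e4].
rewrite !mul_mx_row block_mxEv => /eq_col_mx[/eq_row_mx[_ T1122] _].
have [u11 u22] := mulmx1_unit T1122.
have {e3} [e32 e31] : T32 *m T11^T = 0 /\ T31 *m T22^T = 0.
  by move/eqP: e3; rewrite row_mx_eq0 => /andP[/eqP-> /eqP->].
have {}e32 : T32 = 0 by rewrite -[T32](mulmxK (_ : T11^T \in unitmx)) ?unitmx_tr // e32 mul0mx.
have {}e31 : T31 = 0 by rewrite -(mulmxK u22 T31) e31 mul0mx.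
exists T11^T, S; split; first by rewrite unitmx_tr.
  by move/eqP: e4; rewrite e31 e32 !mul0mx !add0r.
rewrite /diagG trmxK e31 e32 row_mx0; congr (block_mx (block_mx _ _ _ _) _ _ _).
have uY : T11^T \in unitmx by rewrite unitmx_tr.
by rewrite -[RHS]mul1mx -[1%:M](trmxK 1%:M) trmx1 -T1122 trmx_mul trmxK mulmxK.
Qed.

Definition point (B : 'M[F]_n) (Z : 'M_(n, 2)) : mxV :=
  AIZ (B - 2%:R^-1 *: (Z *m Delta z *m Z^T)) Z.

Lemma point_inj (B B' : 'M[F]_n) (Z Z' : 'M_(n, 2)) :
  point B Z = point B' Z' -> B = B' /\ Z = Z'.
Proof. by move=> /AIZ_inj[+ ZZ]; rewrite ZZ => /addIr. Qed.

Lemma point0 : point 0 0 = P1 F n.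
Proof. by rewrite /point !mul0mx scaler0 subr0. Qed.

Lemma orbit_pointP (B : 'M[F]_n) (Z : 'M_(n, 2)) (V : mxV) :
  reflect (exists Y S, [/\ Y \in unitmx, isO2 z S &
             V = point (Y *m B *m Y^T) (Y *m Z *m S)])
          (V \in orbit01 z (point B Z)).
Proof.
have E Y S : Y \in unitmx -> isO2 z S ->
    act (point B Z) (diagG Y S) = point (Y *m B *m Y^T) (Y *m Z *m S).
  move=> uY oS; rewrite AIZ_diagG //; congr AIZ.
  rewrite mulmxBr mulmxBl -scalemxAr -scalemxAl; congr (_ - _ *: _).
  by rewrite -{1}(eqP oS) !trmx_mul !mulmxA.
apply: (iffP imsetP) => [[T /G01_diagG[Y [S [uY oS ->]]] ->] | [Y [S [uY oS ->]]]].
  by exists Y, S; split=> //; apply: E.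
by exists (diagG Y S); [apply: diagG_in | rewrite E].
Qed.

Lemma LambdaP (V : mxV) : 2%:R != 0 :> F ->
  reflect (exists B Z, skew B /\ V = point B Z) (V \in Lambda n z).
Proof.
move=> two0.
have tr (Z : 'M_(n, 2)) : (2%:R^-1 *: (Z *m Delta z *m Z^T))^T =
                          2%:R^-1 *: (Z *m Delta z *m Z^T).
  rewrite linearZ /=; congr (_ *: _); rewrite !trmx_mul trmxK mulmxA; congr (_ *m _ *m _).
  by apply: mx2P; rewrite !mxE.
have half (M : 'M[F]_n) : 2%:R^-1 *: M + 2%:R^-1 *: M = M.
  by rewrite -scalerDl (_ : _ + _ = 1) ?scale1r //; field.
apply: (iffP imsetP) => [[[A Z]] /= | [B [Z [sB ->]]]].
  rewrite inE /= => /eqP eA ->; exists (A + 2%:R^-1 *: (Z *m Delta z *m Z^T)), Z.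
  split; last by rewrite /point addrK.
  rewrite /skew linearD /= tr; apply/eqP; rewrite -subr_eq0 opprK.
  by rewrite addrACA half (addrC A^T) eA.
exists (B - 2%:R^-1 *: (Z *m Delta z *m Z^T), Z) => //=.
rewrite inE /= linearB /= tr sB; apply/eqP.
by rewrite addrACA subrr add0r -opprD half addNr.
Qed.

Lemma orbit_act (B Y : 'M[F]_n) (Z : 'M_(n, 2)) S :
    Y \in unitmx -> isO2 z S ->
  orbit01 z (point (Y *m B *m Y^T) (Y *m Z *m S)) = orbit01 z (point B Z).
Proof.
have sub (C X : 'M[F]_n) (W : 'M_(n, 2)) T : X \in unitmx -> isO2 z T ->
    orbit01 z (point (X *m C *m X^T) (X *m W *m T)) \subset orbit01 z (point C W).
  move=> uX oT; apply/subsetP=> _ /orbit_pointP[X' [T' [uX' oT' ->]]].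
  apply/orbit_pointP; exists (X' *m X), (T *m T').
  by split; rewrite ?unitmx_mul ?uX' ?isO2_mul // trmx_mul !mulmxA.
move=> uY oS; have uS := isO2_unit z_neq0 oS.
apply/eqP; rewrite eqEsubset sub //=.
have := sub (Y *m B *m Y^T) (invmx Y) (Y *m Z *m S) (invmx S).
rewrite unitmx_inv uY isO2_inv // => /(_ isT isT).
by rewrite -!mulmxA mulKmx // mulmxV // -trmx_mul mulVmx // trmx1 !mulmx1 mulKmx.
Qed.

Lemma mem_orbit_point (B : 'M[F]_n) (Z : 'M_(n, 2)) :
  point B Z \in orbit01 z (point B Z).
Proof.
apply/orbit_pointP; exists 1%:M, 1%:M; rewrite unitmx1 /isO2.
by rewrite !trmx1 !mul1mx !mulmx1.
Qed.

End Orbits.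

(** * The seven kinds of pairs, and why every pair has one *)

Section Kinds.

Variables (F : finFieldType) (z : F).
Hypotheses (two_neq0 : 2%:R != 0 :> F).
Hypotheses (z_nsq : ~~ is_square z) (z1_nsq : ~~ is_square (1 - z)).

(* How the column space of [Z] meets the column space of [B]: [Z] vanishes;
   [Z] is a line outside or inside it; [Z] is a plane meeting it in a line, in
   [0], or contained in it with nonzero or zero induced alternating form. *)
Inductive kind :=
| KZero
| KLineOut of F
| KLineIn of F
| KPlaneLine of F
| KPlaneOut
| KPlaneNondeg of F
| KPlaneIso.

Record datum := Datum {
  da : nat; dp : nat; dJ : 'M[F]_dp; dC : 'M[F]_(da, 2); dD : 'M[F]_(dp, 2)
}.

(** A line inside the column space is isotropic, and so is the plane of [KPlaneIso]; their own Gram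
    matrices vanish. Each such vector therefore gets a hyperbolic partner, which makes [J]
    invertible and enters [Z] with coefficient [0]: hence the zero blocks on top in [dD]. *)
Definition kdatum (k : kind) : datum :=
  match k with
  | KZero => Datum (0 : 'M_0) (0 : 'M_(0, 2)) 0
  | KLineOut a => Datum (0 : 'M_0) (row1 a) 0
  | KLineIn a => Datum (symp F 1) (0 : 'M_(0, 2)) (col_mx 0 (row1 a))
  | KPlaneLine a => Datum (symp F 1) (row1 a) (col_mx 0 (delta_mx 0 1))
  | KPlaneOut => Datum (0 : 'M_0) 1%:M 0
  | KPlaneNondeg c => Datum (c *: A2 F) (0 : 'M_(0, 2)) 1%:M
  | KPlaneIso => Datum (symp F 2) (0 : 'M_(0, 2)) (col_mx 0 1%:M)
  end.

Definition kind_ok (k : kind) : bool :=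
  match k with
  | KLineOut a | KLineIn a | KPlaneLine a => (a == 0) || (a == 1)
  | KPlaneNondeg c => c != 0
  | _ => true
  end.

Definition kshape n (k : kind) (B : 'M_n) (Z : 'M_(n, 2)) : Prop :=
  shape B Z (dJ (kdatum k)) (dC (kdatum k)) (dD (kdatum k)).

Definition has_kind n (k : kind) (B : 'M_n) (Z : 'M_(n, 2)) : Prop :=
  exists2 S, isO2 z S & kshape k B (Z *m S).

Lemma isO2_1 : isO2 z 1%:M.
Proof. by rewrite /isO2 trmx1 mulmx1 mul1mx. Qed.

Lemma kshape_has_kind n k (B : 'M_n) (Z : 'M_(n, 2)) :
  kshape k B Z -> has_kind k B Z.
Proof. by exists 1%:M; rewrite ?mulmx1 // isO2_1. Qed.

Let z0 : z != 0 := z_neq0 z_nsq.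

Lemma has_kind_zeroP n (B : 'M_n) (Z : 'M_(n, 2)) :
  has_kind (KZero) B Z <-> Z = 0.
Proof.
split=> [[S /(isO2_unit z0) uS [U [x [H [_ _ _ ZS]]]]] | ->].
  by rewrite -(mulmxK uS Z) ZS /= !mulmx0 addr0 mul0mx.
apply: kshape_has_kind; exists 0, 0, 0; split.
- exact: flatmx0.
- by rewrite [LHS]flatmx0 [RHS]flatmx0.
- exact: flatmx0.
- by rewrite !mulmx0 addr0.
Qed.

Lemma A2_unit (c : F) : c != 0 -> c *: A2 F \in unitmx.
Proof.
move=> c0; rewrite unitmxE unitfE det_mx22 !mxE /= !(mulr0, mulr1, mulrN, mul0r).
by rewrite sub0r opprK mulf_neq0.
Qed.

Lemma kdatum_unit k : kind_ok k -> dJ (kdatum k) \in unitmx.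
Proof.
case: k => [|?|?|?||c|] /= ok; rewrite ?symp_unit ?A2_unit //.
all: by rewrite unitmxE det_mx00 unitr1.
Qed.

Lemma has_kind_equiv n k (B B' : 'M_n) (Z Z' : 'M_(n, 2)) :
    kind_ok k -> skew B -> skew B' -> \rank B = \rank B' ->
    has_kind k B Z -> has_kind k B' Z' ->
  exists Y S, [/\ Y \in unitmx, isO2 z S, B' = Y *m B *m Y^T & Z' = Y *m Z *m S].
Proof.
move=> /kdatum_unit uJ sB sB' rB [S oS sh] [S' oS' sh'].
have [Y [uY YB YZ]] := shape_equiv two_neq0 sB sB' uJ rB sh sh'.
exists Y, (S *m invmx S'); rewrite isO2_mul ?isO2_inv //; split=> //.
by rewrite mulmxA -(mulmxA Y) YZ mulmxK // (isO2_unit z0).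
Qed.

Lemma has_kind_act n k (B Y : 'M_n) (Z : 'M_(n, 2)) S :
    Y \in unitmx -> isO2 z S -> has_kind k B Z ->
  has_kind k (Y *m B *m Y^T) (Y *m Z *m S).
Proof.
move=> uY oS [T oT sh]; exists (invmx S *m T); first by rewrite isO2_mul ?isO2_inv.
have uS := isO2_unit z0 oS.
have := shape_act 1%:M uY sh; rewrite !mulmx1 /kshape.
by rewrite !mulmxA mulmxK.
Qed.

Lemma has_kind_bounds n k (B : 'M_n) (Z : 'M_(n, 2)) :
    kind_ok k -> skew B -> has_kind k B Z ->
  (dp (kdatum k) <= \rank B /\ \rank B + da (kdatum k) <= n)%N.
Proof. by move=> /kdatum_unit uJ sB [S _ /(shape_bounds sB uJ)]. Qed.

Lemma row1E (a : F) : row1 a 0 0 = 1.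
Proof. by rewrite mxE. Qed.

Lemma row1_neq0 (a : F) : row1 a != 0.
Proof.
by apply/eqP => /rowP/(_ 0)/eqP; rewrite row1E mxE oner_eq0.
Qed.

Lemma rank1_normal m (M : 'M[F]_(m, 2)) : \rank M = 1%N ->
  exists S a, [/\ isO2 z S, (a == 0) || (a == 1) & (M *m S :=: row1 a)%MS].
Proof.
move=> rM; have /rowV0Pn[v vM v0] : M != 0 by rewrite -mxrank_eq0 rM.
have [S [l [a [oS l0 aP vS]]]] := rotate z_nsq z1_nsq v0.
have uS := isO2_unit z0 oS.
exists S, a; split=> //; apply: eqmx_sym; apply/eqmxP.
have sub : (row1 a <= M *m S)%MS.
  by rewrite -(eqmx_scale _ l0) -vS submxMr.
rewrite -(mxrank_leqif_eq sub) rank_rV row1_neq0 mxrankMfree ?rM //.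
by rewrite row_free_unit.
Qed.

(** The rows [row1 a] and [(0, 1)] form a basis of the plane; the two columns applied to [Z] are the
    dual basis. *)
Lemma line_split n (Z : 'M[F]_(n, 2)) (a : F) :
  Z = Z *m delta_mx 0 0 *m row1 a
      + Z *m (delta_mx 1 0 - a *: delta_mx 0 0) *m delta_mx (0 : 'I_1) 1.
Proof.
rewrite -!mulmxA -mulmxDr -[LHS]mulmx1; congr (_ *m _).
apply: mx2P; rewrite !mxE !big_ord_recl !big_ord0 !mxE /=; ring.
Qed.

Lemma dual_row n (y : 'cV[F]_n) : y != 0 -> exists e : 'rV_n, e *m y = 1%:M.
Proof.
move=> /matrix0Pn[i [j yij]]; exists ((y i j)^-1 *: delta_mx 0 i).
rewrite -scalemxAl -rowE [LHS]mx11_scalar !mxE.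
by rewrite [j]ord1 in yij *; rewrite mulVf.
Qed.

Lemma hyperbolic_gram n (B : 'M[F]_n) (e : 'rV_n) (f : 'cV_n) :
  skew B -> e *m (B *m f) = 1%:M ->
  col_mx e f^T *m B *m (col_mx e f^T)^T = symp F 1.
Proof.
move=> sB eBf; apply: gram_symp; rewrite ?trmxK -?mulmxA //.
  by rewrite mulmxA; apply: skew_mx1; rewrite // ; apply: skew_congr.
by rewrite mulmxA -{2}[f]trmxK; apply: skew_mx1; rewrite //; apply: skew_congr.
Qed.

Lemma skew_mx2 (G : 'M[F]_2) : skew G -> G = G 0 1 *: A2 F.
Proof.
move=> sG; have e10 : G 1 0 = - G 0 1.
  by have /matrixP/(_ 0 1) := sG; rewrite !mxE.
by apply: mx2P; rewrite !mxE /= ?(skew_diag two_neq0) // ?mulr0 ?mulr1 // e10 mulrN1.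
Qed.

Lemma has_kind_exists n (B : 'M_n) (Z : 'M_(n, 2)) :
  skew B -> exists2 k, kind_ok k & has_kind k B Z.
Proof.
move=> sB; have rK : (\rank (kermx B *m Z) <= 2)%N by exact: rank_leq_col.
have [K0 | K_neq0] := eqVneq (kermx B *m Z) 0; last first.
  have [K2 | K_lt2] := eqVneq (\rank (kermx B *m Z)) 2%N.
    have /row_fullP[L LK] : row_full (kermx B *m Z) by rewrite /row_full K2.
    exists KPlaneOut => //; apply: kshape_has_kind.
    exists Z, (L *m kermx B), 0; split.
    - by rewrite -mulmxA mulmx_ker mulmx0.
    - by rewrite -mulmxA.
    - exact: flatmx0.
    - by rewrite mulmx1 mulmx0 addr0.
  have [|S [a [oS aP eK]]] := @rank1_normal _ (kermx B *m Z).
    by move: K_neq0 K_lt2 rK; rewrite -mxrank_eq0; case: (\rank _) => [|[|[|]]].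
  have /submxP[w ew] : (row1 a <= kermx B *m Z *m S)%MS by rewrite eK.
  (* The column applied to [Z *m S] is annihilated by [row1 a], so [y] is a combination of columns
     that lies in the column space of [B]. Whether [y] vanishes separates [KLineOut] from
     [KPlaneLine]. *)
  pose y : 'cV_n := Z *m S *m (delta_mx 1 0 - a *: delta_mx 0 0).
  have [f yf] : exists f, y = B *m f.
    apply: skew_image sB _.
    have /submxP[t et] : (kermx B *m Z *m S <= row1 a)%MS by rewrite eK.
    rewrite /y !mulmxA et -mulmxA [X in _ *m X](_ : _ = 0) ?mulmx0 //.
    apply/matrixP=> i j; rewrite !ord1 !mxE !big_ord_recl big_ord0 !mxE /=; ring.
  have xB : w *m kermx B *m B = 0 by rewrite -mulmxA mulmx_ker mulmx0.
  have xU : w *m kermx B *m (Z *m S *m (delta_mx 0 0 : 'cV_2)) = 1%:M.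
    have -> : w *m kermx B *m (Z *m S *m (delta_mx 0 0 : 'cV_2)) =
              w *m (kermx B *m Z *m S) *m delta_mx 0 0 by rewrite !mulmxA.
    by rewrite -ew -colE [LHS]mx11_scalar mxE row1E.
  have eZ := line_split (Z *m S) a; rewrite -/y in eZ.
  have [y0 | y_neq0] := eqVneq y 0.
    exists (KLineOut a) => //; exists S => //.
    exists (Z *m S *m delta_mx 0 0), (w *m kermx B), 0; split=> //.
      exact: flatmx0.
    by rewrite mulmx0 addr0 {1}eZ y0 mul0mx addr0.
  have [e ey] := dual_row y_neq0.
  exists (KPlaneLine a) => //; exists S => //.
  exists (Z *m S *m delta_mx 0 0), (w *m kermx B), (col_mx e f^T); split=> //.
    by apply: hyperbolic_gram; rewrite -?yf.
  rewrite tr_col_mx trmxK -(mulmxA B) mul_row_col mulmx0 add0r mulmxA -yf.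
  exact: eZ.
(* All columns of [Z] now lie in the column space of [B], and [W^T *m B *m W] is the form induced on
   them, given by a single entry. *)
have [W ZW] := skew_image sB K0.
have sG : skew (W^T *m B *m W).
  by rewrite -{2}[W]trmxK; apply: skew_congr.
have [c0 | c_neq0] := eqVneq ((W^T *m B *m W) 0 1) 0; last first.
  exists (KPlaneNondeg ((W^T *m B *m W) 0 1)) => //; apply: kshape_has_kind.
  exists 0, 0, W^T; split; rewrite ?mul0mx //.
  - by rewrite [LHS]flatmx0 [RHS]flatmx0.
  - by rewrite trmxK [LHS]skew_mx2.
  - by rewrite mulmx1 trmxK add0r.
have WBW : W^T *m B *m W = 0 by rewrite [LHS]skew_mx2 // c0 scale0r.
have [Z0 | Z_neq0] := eqVneq Z 0.
  by exists KZero => //; apply/has_kind_zeroP.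
have [Z2 | Z_lt2] := eqVneq (\rank Z) 2%N; last first.
  have [|S [a [oS aP eZS]]] := @rank1_normal _ Z.
    have := rank_leq_col Z; move: Z_neq0 Z_lt2; rewrite -mxrank_eq0.
    by case: (\rank _) => [|[|[|]]].
  have uS := isO2_unit z0 oS.
  have /submxP[t et] : (Z *m S <= row1 a)%MS by rewrite eZS.
  have tf : t = B *m (W *m S *m delta_mx 0 0).
    rewrite !mulmxA -ZW et -mulmxA -colE.
    by rewrite [X in _ *m X]mx11_scalar mxE row1E mulmx1.
  have t0 : t != 0.
    apply: contraNneq Z_neq0 => t0.
    by rewrite -(mulmxK uS Z) et t0 !mul0mx.
  have [e ey] := dual_row t0.
  exists (KLineIn a) => //; exists S => //.
  exists 0, 0, (col_mx e (W *m S *m delta_mx 0 0)^T); split; rewrite ?mul0mx //.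
  - by rewrite [LHS]flatmx0 [RHS]flatmx0.
  - by apply: hyperbolic_gram; rewrite -?tf.
  - rewrite tr_col_mx trmxK -(mulmxA B) mul_row_col mulmx0 !add0r.
    by rewrite mulmxA -tf.
have /row_fullP[E0 E0Z] : row_full Z by rewrite /row_full Z2.
have WZ : W^T *m Z = 0 by rewrite ZW mulmxA.
(* Correct [E0] by a multiple of [W^T] to make it totally isotropic. *)
pose s := 2%:R^-1 *: (E0 *m B *m E0^T).
have sN : skew (E0 *m B *m E0^T) by exact: skew_congr.
have BE0 : W^T *m B *m E0^T = - 1%:M.
  by apply: trmx_inj; rewrite skew_tr_mul // -mulmxA trmxK -ZW E0Z linearN /= trmx1.
pose E1 := E0 + s *m W^T.
have E1Z : E1 *m Z = 1%:M by rewrite mulmxDl E0Z -mulmxA WZ mulmx0 addr0.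
exists KPlaneIso => //; apply: kshape_has_kind.
exists 0, 0, (col_mx E1 W^T); split; rewrite ?mul0mx //.
- by rewrite [LHS]flatmx0 [RHS]flatmx0.
- apply: gram_symp => //; rewrite ?trmxK // -?[E1 *m B *m W]mulmxA -?ZW //.
  have -> : E1 *m B *m E1^T = E0 *m B *m E0^T + s *m (W^T *m B *m E0^T)
                              + E1 *m (B *m W) *m s^T.
    by rewrite {2}/E1 linearD /= trmx_mul trmxK mulmxDr !mulmxA {1}/E1 !mulmxDl ?mulmxA.
  have sT : s^T = - s by rewrite /s linearZ /= sN scalerN.
  rewrite BE0 -ZW E1Z mul1mx mulmxN mulmx1 sT -addrA -opprD /s -scalerDl.
  by rewrite (_ : _ + _ = 1) ?scale1r ?subrr //; field.
- rewrite add0r tr_col_mx trmxK -(mulmxA B) mul_row_col mulmx0 add0r mulmx1.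
  exact: ZW.
Qed.

End Kinds.

(** * Uniqueness of the kind of a pair *)

Section KindUniqueness.

Variables (F : finFieldType) (z : F).
Hypotheses (z_nsq : ~~ is_square z) (z1_nsq : ~~ is_square (1 - z)).

Let z0 : z != 0 := z_neq0 z_nsq.

Definition kind_rank (k : kind F) : nat :=
  match k with
  | KZero => 0
  | KLineOut _ | KLineIn _ => 1
  | _ => 2
  end.

Lemma rank_dC (k : kind F) : \rank (dC (kdatum k)) = da (kdatum k).
Proof.
case: k => [|a|a|a||c|] /=; rewrite ?mxrank1 ?rank_rV ?row1_neq0 //.
all: by rewrite mxrank0.
Qed.

Lemma rank_dCD (k : kind F) :
  \rank (col_mx (dC (kdatum k)) (dD (kdatum k))) = kind_rank k.
Proof.
case: k => [|a|a|a||c|] /=.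
- by rewrite rank_col_mx0 mxrank0.
- by rewrite rank_col_mx0 rank_rV row1_neq0.
- by rewrite !rank_col_0mx rank_rV row1_neq0.
- apply/eqP/row_fullP; have := line_split (1%:M : 'M[F]_2) a.
  set u := _ *m delta_mx 0 0; set v := _ *m (_ - _) => e.
  by exists (row_mx u (row_mx 0 v)); rewrite !mul_row_col mul0mx add0r -e.
- by rewrite rank_col_mx0 mxrank1.
- by rewrite rank_col_0mx mxrank1.
- by rewrite !rank_col_0mx mxrank1.
Qed.

Lemma row1_norm (a : F) (T : 'M_2) : isO2 z T ->
  row1 a *m T *m Delta z *m (row1 a *m T)^T = (1 - z * a ^+ 2)%:M.
Proof.
move=> /eqP oT; rewrite trmx_mul !mulmxA -[_ *m T *m _ *m _]mulmxA -(mulmxA _ T).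
rewrite (mulmxA T) oT [LHS]mx11_scalar; congr _%:M.
rewrite !mxE !big_ord_recl big_ord0 !mxE !big_ord_recl !big_ord0 !mxE /=; ring.
Qed.

(** Comparing norms gives [1 - z a^2 = l^2 (1 - z a'^2)]; for distinct [a] and [a'] this would make
    [1 - z] a square. *)
Lemma row1_class (a a' : F) (T : 'M_2) :
    (a == 0) || (a == 1) -> (a' == 0) || (a' == 1) -> isO2 z T ->
  (row1 a *m T <= row1 a')%MS -> a = a'.
Proof.
move=> aP aP' oT /sub_rVP[l el]; have := row1_norm a oT.
have := row1_norm a' (isO2_1 z); rewrite mulmx1 => na'.
rewrite el linearZ /= -scalemxAr -!scalemxAl na' !scale_scalar_mx.
move=> /(congr1 (fun M : 'M_1 => M 0 0)); rewrite !mxE !eqxx !mulr1n.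
case/orP: aP aP' => /eqP-> /orP[]/eqP-> //; rewrite expr0n expr1n !(mulr0, mulr1, subr0) => e.
  case/existsP: z1_nsq; exists l^-1; have l0 : l != 0.
    by apply: contra_eq_neq e => ->; rewrite mul0r eq_sym oner_eq0.
  by rewrite -(inj_eq (mulfI l0)) -(inj_eq (mulfI l0)) e expr2 mulVKf // divff.
by case/existsP: z1_nsq; exists l; rewrite expr2 e.
Qed.

(** An isometry [T] of the plane multiplies the induced alternating form by [det T], which is [1] or
    [-1]; so only [c^2] is an invariant. *)
Definition kind_equiv (k k' : kind F) : Prop :=
  match k, k' with
  | KPlaneNondeg c, KPlaneNondeg c' => c ^+ 2 = c' ^+ 2
  | _, _ => k = k'
  end.

Lemma det_A2 (c : F) : \det (c *: A2 F) = c ^+ 2.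
Proof. by rewrite det_mx22 !mxE /=; ring. Qed.

Lemma kind_unique n k k' (B : 'M_n) (Z : 'M_(n, 2)) :
    skew B -> kind_ok k -> kind_ok k' ->
    has_kind z k B Z -> has_kind z k' B Z ->
  kind_equiv k k'.
Proof.
move=> sB ok ok' [S oS sh] [S' oS' sh'].
pose T := invmx S *m S'; have oT : isO2 z T by rewrite isO2_mul ?isO2_inv.
have uS := isO2_unit z0 oS; have uT := isO2_unit z0 oT.
have fT : row_free T by rewrite row_free_unit.
have {}sh : shape B (Z *m S') (dJ (kdatum k)) (dC (kdatum k) *m T) (dD (kdatum k) *m T).
  have := shape_act T (unitmx1 F n) sh.
  by rewrite trmx1 !mulmx1 !mul1mx /T mulmxA mulmxK.
clearbody T.
have eC : da (kdatum k) = da (kdatum k').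
  by rewrite -(rank_dC k) -(rank_dC k') -(shape_rank sh') (shape_rank sh) mxrankMfree.
have rs := eqmx_trans (eqmx_sym (shape_row_space (kdatum_unit ok) sh))
  (shape_row_space (kdatum_unit ok') sh').
rewrite -mul_col_mx in rs.
have eZ : kind_rank k = kind_rank k'.
  by rewrite -(rank_dCD k) -(rank_dCD k') -(mxrankMfree _ fT) rs.
have detT : \det T ^+ 2 = 1 by exact: isO2_det oT.
(* The numbers [da] and [kind_rank] separate all constructors except [KPlaneNondeg] and [KPlaneIso];
   the determinant of the induced form tells these apart. *)
case: k k' ok ok' sh sh' eC rs eZ => [|a|a|a||c|] [|a'|a'|a'||c'|] //= ok ok' sh sh' _ rs _.
- congr KLineOut; apply: row1_class ok ok' oT _.
  exact: shape_coeff_sub sh sh'.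
- congr KLineIn; apply: row1_class ok ok' oT _.
  have : (col_mx (0 : 'M_(0, 2)) (col_mx (0 : 'rV_2) (row1 a')) <= row1 a')%MS.
    by rewrite !col_mx_sub !sub0mx submx_refl.
  rewrite -rs !mul_col_mx !col_mx_sub.
  by case/andP => _ /andP[].
- congr KPlaneLine; apply: row1_class ok ok' oT _.
  exact: shape_coeff_sub sh sh'.
- have := shape_form sB sh sh'.
  rewrite mul1mx trmx1 mulmx1 mul1mx => /(congr1 determinant).
  by rewrite !det_mulmx det_tr !det_A2 mulrAC -expr2 detT mul1r.
- have := shape_form sB sh sh'.
  rewrite mul1mx tr_col_mx trmx0 trmx1 mul_row_block mul_row_col.
  rewrite !(mul0mx, mulmx0, addr0, mulmx1) => /(congr1 determinant).
  rewrite !det_mulmx det_tr det_A2 mulrAC -expr2 detT mul1r det0 => /eqP.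
  by rewrite expf_eq0 (negPf ok).
- have := shape_form sB sh' sh.
  rewrite mul_col_mx mul1mx mul0mx tr_col_mx trmx0 trmx1 mul_row_block mul_row_col.
  rewrite !(mul0mx, mulmx0, addr0, mulmx1, mul1mx) => /(congr1 determinant).
  rewrite det_A2 det0 => /eqP.
  by rewrite expf_eq0 (negPf ok').
Qed.

End KindUniqueness.

(** * Sizes, ranks and regrouping of block diagonal matrices *)

Section BlockDiagonal.

Variable F : finFieldType.

Definition bsize (s : seq (block F)) : nat := sumn [seq tag X | X <- s].

Lemma bsizeE s :
  (\sum_(i < size s) tag (nth (blk (0 : 'M[F]_0)) s i))%N = bsize s.
Proof. by rewrite /bsize sumnE big_map (big_nth (blk (0 : 'M[F]_0))) big_mkord. Qed.

Lemma bdiag_cons n1 n2 (X : 'M[F]_n1) s :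
  bsize s = n2 -> bdiag (n1 + n2) (blk X :: s) = block_mx X 0 0 (bdiag n2 s).
Proof.
rewrite -bsizeE => <-; rewrite /bdiag /= mxdiag_recl conform_castmx !conform_mx_id.
by [].
Qed.

Lemma bdiag_zblk n : bdiag n [:: zblk F n] = 0.
Proof.
have gen m : m = (n + 0)%N -> bdiag m [:: zblk F n] = 0.
  by move=> ->; rewrite bdiag_cons // [bdiag 0 _]flatmx0 block_mx0.
by apply: gen; rewrite addn0.
Qed.

(** Serves to merge the leading [0] and the first [A2] of [phi4] into one block of size three, the
    part that meets [Z]. *)
Lemma bdiag_cat2 n1 n2 (X : 'M[F]_n1) (Y : 'M[F]_n2) N s :
    N = (n1 + (n2 + bsize s))%N ->
  bdiag N (blk X :: blk Y :: s) = bdiag N (blk (block_mx X 0 0 Y) :: s).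
Proof.
have gen M (e : (n1 + n2 + bsize s)%N = M) :
    bdiag M (blk (block_mx X 0 0 Y) :: s) =
    castmx (e, e) (block_mx (block_mx X 0 0 Y) 0 0 (bdiag _ s)).
  by case: M / e; rewrite castmx_id bdiag_cons.
move=> ->; rewrite !bdiag_cons // (gen _ (esym (addnA _ _ _))).
have := @block_mxA _ _ _ _ _ _ _ X 0 0 0 Y 0 0 0 (bdiag (bsize s) s).
by rewrite /= row_mx0 !col_mx0 row_mx0 => ->.
Qed.

Lemma bsize_tail r m : bsize (rcons (A2s F r) (zblk F m)) = (2 * r + m)%N.
Proof.
rewrite /bsize map_rcons -cats1 sumn_cat /= addn0; congr (_ + _)%N.
by elim: r => [|r IH] //=; rewrite IH mulnS.
Qed.

Lemma A2_skew : skew (A2 F).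
Proof. by apply: mx2P; rewrite !mxE /= ?oppr0 ?opprK. Qed.

Lemma bdiag_tail r m N : N = (2 * r + m)%N ->
  skew (bdiag N (rcons (A2s F r) (zblk F m))) /\
  \rank (bdiag N (rcons (A2s F r) (zblk F m))) = (2 * r)%N.
Proof.
elim: r N => [|r IH] N eN.
  by rewrite eN muln0 /= bdiag_zblk mxrank0 /skew trmx0 oppr0.
have {eN} -> : N = (2 + (2 * r + m))%N by rewrite eN mulnS addnA.
have [sk rk] := IH _ erefl.
rewrite /= bdiag_cons ?bsize_tail // rank_diag_block_mx rk mulnS; split.
  by rewrite /skew tr_block_mx !trmx0 opp_block_mx !oppr0 sk A2_skew.
by rewrite -[A2 F]scale1r mxrank_unit // A2_unit ?oner_neq0.
Qed.

End BlockDiagonal.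

(** * The matrices [Z] of the list and their correction terms *)

Section PhiPoints.

Variables (F : finFieldType) (z : F).

Lemma Ecol_col n m k : (k <= n)%N -> Ecol F (n + m) k = col_mx (Ecol F n k) 0.
Proof.
move=> kn; apply/colP=> i; rewrite !mxE; case: splitP => j ->; rewrite mxE //.
by case: eqP => // e; rewrite -e -addnS -{2}[n]addn0 leq_add2l in kn.
Qed.

Lemma Z1_col n m (a : F) : (0 < n)%N -> Z1 (n + m) a = col_mx (Z1 n a) 0.
Proof.
move=> n0; rewrite /Z1 Ecol_col // scale_col_mx scaler0.
by rewrite -block_mxEh block_mxEv row_mx0.
Qed.

Lemma Z2_col n m : (1 < n)%N -> Z2 F (n + m) = col_mx (Z2 F n) 0.
Proof.
move=> n1; rewrite /Z2 !Ecol_col ?(ltnW n1) //.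
by rewrite -block_mxEh block_mxEv row_mx0.
Qed.

Lemma col_mx_form n m (Z : 'M[F]_(n, 2)) :
  col_mx Z (0 : 'M_(m, 2)) *m Delta z *m (col_mx Z (0 : 'M_(m, 2)))^T =
  block_mx (Z *m Delta z *m Z^T) 0 0 0.
Proof.
by rewrite tr_col_mx trmx0 mul_col_mx mul0mx mul_col_row !mulmx0 !mul0mx.
Qed.

Lemma Z1_1 (a : F) : Z1 1 a = row1 a.
Proof.
by apply/rowP=> i; rewrite !mxE; case: splitP => j ->; rewrite [j]ord1 !mxE ?mulr1.
Qed.

(** The only entry of [Z Delta Z^t] that can be nonzero is the norm [1 - z a^2] of [(1, a)]; the
    scalar block of the list is thus the correction term built into [point]. *)
Lemma half_Z1 N (a : F) : (0 < N)%N ->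
  bdiag N [:: sblk z a; zblk F (N - 1)] =
  - (2%:R^-1 *: (Z1 N a *m Delta z *m (Z1 N a)^T)).
Proof.
case: N => // m _; rewrite subn1 /=.
have -> : m.+1 = (1 + m)%N by [].
rewrite bdiag_cons ?bdiag_zblk; last by rewrite /bsize /= addn0.
rewrite Z1_col // col_mx_form scale_block_mx opp_block_mx !scaler0 !oppr0.
rewrite Z1_1; have := row1_norm a (isO2_1 z); rewrite mulmx1 => ->.
by rewrite scale_scalar_mx -raddfN /= mulrC.
Qed.

Lemma Z2_1 : Z2 F 2 = 1%:M.
Proof.
by apply: mx2P; rewrite !mxE; case: splitP => -[[|[|j]] lt_j] //= _; rewrite mxE.
Qed.

Lemma half_Z2 N : (1 < N)%N ->
  bdiag N [:: blk (mhalfDelta z); zblk F (N - 2)] =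
  - (2%:R^-1 *: (Z2 F N *m Delta z *m (Z2 F N)^T)).
Proof.
case: N => [|[|m]] // _; rewrite subn2 /=.
have -> : m.+2 = (2 + m)%N by [].
rewrite bdiag_cons ?bdiag_zblk; last by rewrite /bsize /= addn0.
rewrite Z2_col // col_mx_form scale_block_mx opp_block_mx !scaler0 !oppr0.
rewrite Z2_1.
by rewrite trmx1 mulmx1 mul1mx.
Qed.

End PhiPoints.

(** * Rank and kind of each listed representative *)

Section PhiKinds.

Variables (F : finFieldType) (z : F).
Hypotheses (two_neq0 : 2%:R != 0 :> F).
Hypotheses (z_nsq : ~~ is_square z).

Local Notation tail r m := (rcons (A2s F r) (zblk F m)).

Lemma bdiag_addl p (X Y : 'M[F]_p) s N : N = (p + bsize s)%N ->
  bdiag N (blk X :: s) + bdiag N [:: blk Y; zblk F (N - p)] =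
  bdiag N (blk (X + Y) :: s).
Proof.
move=> ->; rewrite addKn !bdiag_cons //; last by rewrite /bsize /= addn0.
by rewrite bdiag_zblk add_block_mx !addr0.
Qed.

(** Below its first [p] rows [Z] vanishes, so the trailing blocks affect the rank but not the kind.
    Every representative with nonzero [Z] is thereby reduced to a core of size at most four. *)
Lemma core_kind p (X : 'M[F]_p) r m N (ZN : forall n, 'M[F]_(n, 2)) k :
    N = (p + (2 * r + m))%N -> skew X ->
    (forall l, ZN (p + l)%N = col_mx (ZN p) 0) -> has_kind z k X (ZN p) ->
  let B := bdiag N (blk X :: tail r m) in
  [/\ skew B, \rank B = (\rank X + 2 * r)%N & has_kind z k B (ZN N)].
Proof.
move=> -> sX eZ [S oS sh]; rewrite /= bdiag_cons ?bsize_tail //.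
have [st rt] := bdiag_tail F (erefl (2 * r + m)%N); split.
- by rewrite /skew tr_block_mx !trmx0 opp_block_mx !oppr0 sX st.
- by rewrite rank_diag_block_mx rt.
- by exists S => //; rewrite eZ mul_col_mx mul0mx; apply: shape_block.
Qed.

Lemma symp1 : symp F 1 = A2 F.
Proof.
by apply: mx2P; rewrite !mxE; case: splitP => -[[|k] klt] //= _; rewrite mxE;
  case: splitP => -[[|l] llt] //= _; rewrite ?mxE.
Qed.

Lemma col_row2 (a b : F) :
  col_mx (0 : 'rV_2) (mx_of_rows 1 2 [:: [:: a; b]]) =
  mx_of_rows 2 2 [:: [:: 0; 0]; [:: a; b]].
Proof.
apply: (@mx2P F); rewrite !mxE;
  by case: splitP => -[[|k] klt] //= _; rewrite ?mxE.
Qed.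

Lemma delta_row2 : delta_mx 0 1 = mx_of_rows 1 2 [:: [:: 0; 1]] :> 'M[F]_(1, 2).
Proof. by apply/rowP=> -[[|[|j]] jlt] //; rewrite !mxE. Qed.

Lemma Z1_2 (a : F) : Z1 2 a = mx_of_rows 2 2 [:: [:: 1; a]; [:: 0; 0]].
Proof.
apply: (@mx2P F); rewrite !mxE;
  by case: splitP => -[[|k] klt] //= _; rewrite !mxE ?mulr1 ?mulr0.
Qed.

Lemma Z2_3 : Z2 F 3 = mx_of_rows 3 2 [:: [:: 1; 0]; [:: 0; 1]; [:: 0; 0]].
Proof.
apply/matrixP=> -[[|[|[|i]]] ilt] // -[[|[|j]] jlt] //; rewrite !mxE;
  by case: splitP => -[[|k] klt] //= _; rewrite !mxE.
Qed.

Lemma block_A2 : block_mx (0 : 'M_1) 0 0 (A2 F) =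
  mx_of_rows 3 3 [:: [:: 0; 0; 0]; [:: 0; 0; 1]; [:: 0; -1; 0]].
Proof.
apply/matrixP=> -[[|[|[|i]]] ilt] // -[[|[|[|j]]] jlt] //; rewrite !mxE;
  case: splitP => -[[|[|k]] klt] //= _; rewrite ?mxE;
  case: splitP => -[[|[|l]] llt] //= _; rewrite ?mxE //.
Qed.

Local Ltac entries :=
  apply/matrixP=> -[[|[|[|i]]] ilt] // -[[|[|[|j]]] jlt] //;
  rewrite !mxE ?big_ord_recl ?big_ord0 ?mxE ?big_ord_recl ?big_ord0 ?mxE
    ?big_ord_recl ?big_ord0 ?mxE /=; ring.

Lemma core_LineOut (a : F) : has_kind z (KLineOut a) (0 : 'M_1) (Z1 1 a).
Proof.
apply: kshape_has_kind; exists 1%:M, 1%:M, 0.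
by rewrite Z1_1 !mulmx0 !mul1mx addr0; split=> //; apply: flatmx0.
Qed.

Lemma core_LineIn (a : F) : has_kind z (KLineIn a) (A2 F) (Z1 2 a).
Proof.
apply: kshape_has_kind; exists 0, 0, 1%:M; split.
- exact: flatmx0.
- by rewrite [LHS]flatmx0 [RHS]flatmx0.
- by rewrite trmx1 mulmx1 mul1mx /= symp1.
- rewrite trmx1 mulmx1 mul0mx add0r /= /row1 col_row2 Z1_2; entries.
Qed.

Lemma core_PlaneLine0 :
  has_kind z (KPlaneLine 0) (block_mx (0 : 'M_1) 0 0 (A2 F)) (Z2 F 3).
Proof.
apply: kshape_has_kind.
exists (mx_of_rows 3 1 [:: [:: 1]; [:: 0]; [:: 0]]),
  (mx_of_rows 1 3 [:: [:: 1; 0; 0]]),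
  (mx_of_rows 2 3 [:: [:: 0; 1; 0]; [:: 0; 0; 1]]).
rewrite /= symp1 block_A2 Z2_3 delta_row2 col_row2; split; entries.
Qed.

(** The row [(1, -1, 0)] annihilates [Ymx] and takes [Z] to [(1, -1)]; the reflection [diag(1, -1)]
    turns this into [(1, 1)], that is [row1 1]. *)
Lemma core_PlaneLine1 : has_kind z (KPlaneLine 1) (Ymx F) (Z2 F 3).
Proof.
exists (mx_of_rows 2 2 [:: [:: 1; 0]; [:: 0; -1]]); first by apply/eqP; entries.
exists (mx_of_rows 3 1 [:: [:: 1]; [:: 0]; [:: 0]]),
  (mx_of_rows 1 3 [:: [:: 1; -1; 0]]),
  (mx_of_rows 2 3 [:: [:: 0; -1; 0]; [:: 0; 0; -1]]).
rewrite /= symp1 Z2_3 delta_row2 col_row2; split; entries.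
Qed.

Lemma core_PlaneOut : has_kind z (@KPlaneOut F) (0 : 'M_2) (Z2 F 2).
Proof.
apply: kshape_has_kind; exists 1%:M, 1%:M, 0.
by rewrite Z2_1 !mulmx0 !mul1mx addr0; split=> //; apply: flatmx0.
Qed.

(** Here [Z] is the identity, so [Z = B W] with [W = B^-1], and the induced form [W^t B W] carries
    the inverse parameter. *)
Lemma core_PlaneNondeg (b : F) : b != 0 ->
  has_kind z (KPlaneNondeg b^-1) (b *: A2 F) (Z2 F 2).
Proof.
move=> b0; apply: kshape_has_kind; exists 0, 0, (b^-1 *: A2 F).
have inv : b *: A2 F *m (b^-1 *: A2 F)^T = 1%:M.
  rewrite linearZ /= -scalemxAl -scalemxAr scalerA divff // scale1r; entries.
split; rewrite ?mul0mx //.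
- by rewrite [LHS]flatmx0 [RHS]flatmx0.
- by rewrite -mulmxA inv mulmx1.
- by rewrite inv mulmx1 add0r Z2_1.
Qed.

Lemma core_PlaneIso : has_kind z (@KPlaneIso F) (Kmx F) (Z2 F 4).
Proof.
apply: kshape_has_kind; exists 0, 0, 1%:M; split; rewrite ?mul0mx //.
- by rewrite [LHS]flatmx0 [RHS]flatmx0.
- by rewrite trmx1 mulmx1 mul1mx.
- rewrite trmx1 mulmx1 add0r (@Z2_col F 2 2) // Z2_1 /= mul_block_col.
  by rewrite !mulmx0 !mul0mx mul1mx add0r addr0.
Qed.

Definition phi_rank (i : phi_index F) : nat :=
  match i with
  | Phi1 r | Phi2 r _ | Phi3 r _ | Phi4 r | Phi5 r | Phi6 r | Phi7 r _ | Phi8 r => r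
  end.

(** [Phi4] changes kind at [r = 0]: there [B = 0], and no line of the plane can lie in the column
    space. [Phi6] continues that kind from [r = 1] on. *)
Definition phi_kind (i : phi_index F) : kind F :=
  match i with
  | Phi1 _ => KZero F
  | Phi2 _ a => KLineOut a
  | Phi3 _ a => KLineIn a
  | Phi4 0 => KPlaneOut F
  | Phi4 _ => KPlaneLine 0
  | Phi5 _ => KPlaneLine 1
  | Phi6 _ => KPlaneOut F
  | Phi7 _ b => KPlaneNondeg b^-1
  | Phi8 _ => KPlaneIso F
  end.

Lemma point_Z1 N (B : 'M[F]_N) (a : F) : (0 < N)%N ->
  AIZ (B + bdiag N [:: sblk z a; zblk F (N - 1)]) (Z1 N a) = point z B (Z1 N a).
Proof. by move=> N0; rewrite half_Z1. Qed.

Lemma point_Z2 N (B : 'M[F]_N) : (1 < N)%N ->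
  AIZ (B + bdiag N [:: blk (mhalfDelta z); zblk F (N - 2)]) (Z2 F N)
  = point z B (Z2 F N).
Proof. by move=> N1; rewrite half_Z2. Qed.

Lemma phi_point nu (Omega : {set F}) i :
    (2 <= nu)%N -> 0 \notin Omega -> phi_index_ok nu Omega i ->
  exists B Z, [/\ phi nu z i = point z B Z, skew B,
    \rank B = (2 * phi_rank i)%N & has_kind z (phi_kind i) B Z].
Proof.
move=> nu2 O0; have nu1 : (0 < nu)%N by exact: ltnW.
have rA c : c != 0 -> \rank (c *: A2 F) = 2 by move=> c0; apply/mxrank_unit/A2_unit.
have rA1 : \rank (A2 F) = 2 by rewrite -[A2 F]scale1r rA ?oner_neq0.
have sA : skew (A2 F) by exact: A2_skew.
have half r k : (r <= (nu - k) %/ 2)%N -> (2 * r <= nu - k)%N.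
  by move=> h; rewrite mulnC; apply: leq_trans (leq_trunc_div _ 2); rewrite leq_mul2r h.
have half0 r : (r <= nu %/ 2)%N -> (2 * r <= nu)%N by have := half r 0; rewrite subn0.
case: i => [r|r a|r a|r|r|r|r b|r] /=.
- case/andP=> _ /half0 hr; rewrite /phi1.
  have e : nu = (2 * r + (nu - 2 * r))%N by rewrite subnKC.
  have [{}sB {}rB] := bdiag_tail F e.
  exists (bdiag nu (tail r (nu - 2 * r))), 0; split=> //.
    by rewrite /point !mul0mx scaler0 subr0.
  by apply/(has_kind_zeroP z_nsq).
- case/andP=> /half hr aP.
  have e : nu = (1 + (2 * r + (nu - 2 * r - 1)))%N by lia.
  have [|sB rB kB] := core_kind (ZN := fun n => Z1 n a) e (@skew0 F 1) _ (core_LineOut a).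
    by move=> l; apply: Z1_col.
  exists (bdiag nu (blk (0 : 'M_1) :: tail r (nu - 2 * r - 1))), (Z1 nu a).
  rewrite rB mxrank0; split=> //; rewrite -point_Z1 // bdiag_addl ?add0r //.
  by rewrite bsize_tail.
(* The first copy of [A2] is the core, which leaves one copy fewer for the tail. *)
- case/andP=> /andP[r1 /half0 hr] aP; case: r r1 hr => // r _ hr.
  have e : nu = (2 + (2 * r + (nu - 2 * r.+1)))%N by lia.
  have [|sB rB kB] := core_kind (ZN := fun n => Z1 n a) e sA _ (core_LineIn a).
    by move=> l; apply: Z1_col.
  exists (bdiag nu (blk (A2 F) :: tail r (nu - 2 * r.+1))), (Z1 nu a).
  by rewrite rB rA1 -mulnS; split=> //; rewrite -point_Z1.
- case: r => [_ | r /half hr].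
    have e : nu = (2 + (2 * 0 + (nu - 2)))%N by lia.
    have [|sB rB kB] := core_kind (ZN := Z2 F) e (@skew0 F 2) _ core_PlaneOut.
      by move=> l; apply: Z2_col.
    exists (bdiag nu (blk (0 : 'M_2) :: tail 0 (nu - 2))), (Z2 F nu).
    rewrite rB mxrank0; split=> //; rewrite -point_Z2 //; congr (AIZ (_ + _) _).
    have zero p m : nu = (p + m)%N -> bdiag nu [:: zblk F p; zblk F m] = 0.
      by move=> ->; rewrite bdiag_cons ?bdiag_zblk ?block_mx0 // /bsize /= addn0.
    by rewrite /= !zero //; lia.
  have e : nu = (1 + 2 + (2 * r + (nu - 1 - 2 * r.+1)))%N by lia.
  have sX : skew (block_mx (0 : 'M_1) 0 0 (A2 F)).
    by rewrite /skew tr_block_mx !trmx0 opp_block_mx !oppr0 sA.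
  have [|sB rB kB] := core_kind (ZN := Z2 F) e sX _ core_PlaneLine0.
    by move=> l; apply: Z2_col.
  exists (bdiag nu (blk (block_mx (0 : 'M_1) 0 0 (A2 F)) ::
                    tail r (nu - 1 - 2 * r.+1))), (Z2 F nu).
  rewrite rB rank_diag_block_mx mxrank0 rA1 -mulnS; split=> //.
  by rewrite -point_Z2 // /phi4 /= bdiag_cat2 // bsize_tail addnA.
- case/andP=> r1 /half hr; case: r r1 hr => // r _ hr.
  have e : nu = (3 + (2 * r + (nu - 1 - 2 * r.+1)))%N by lia.
  have sX : skew (Ymx F).
    apply/matrixP=> -[[|[|[|i]]] ilt] // -[[|[|[|j]]] jlt] //;
    by rewrite !mxE /= ?oppr0 ?opprK.
  (* The rank is even, nonzero and at most three. *)
  have rX : \rank (Ymx F) = 2.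
    have : Ymx F != 0.
      by apply/eqP=> /matrixP/(_ 0 2%:R)/eqP; rewrite !mxE /= oner_eq0.
    rewrite -mxrank_eq0; have := rank_leq_row (Ymx F).
    by have := skew_rank_even two_neq0 sX; case: (\rank _) => [|[|[|[|]]]].
  have [|sB rB kB] := core_kind (ZN := Z2 F) e sX _ core_PlaneLine1.
    by move=> l; apply: Z2_col.
  exists (bdiag nu (blk (Ymx F) :: tail r (nu - 1 - 2 * r.+1))), (Z2 F nu).
  by rewrite rB rX -mulnS; split=> //; rewrite -point_Z2 // /phi5 subn1.
- case/andP=> r1 /half hr.
  have e : nu = (2 + (2 * r + (nu - 2 * r - 2)))%N by lia.
  have [|sB rB kB] := core_kind (ZN := Z2 F) e (@skew0 F 2) _ core_PlaneOut.
    by move=> l; apply: Z2_col.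
  exists (bdiag nu (blk (0 : 'M_2) :: tail r (nu - 2 * r - 2))), (Z2 F nu).
  rewrite rB mxrank0; split=> //; rewrite -point_Z2 // bdiag_addl ?add0r //.
  by rewrite bsize_tail.
- case/andP=> /andP[r1 /half0 hr] bO; case: r r1 hr => // r _ hr.
  have b0 : b != 0 by apply: contraNneq O0 => <-.
  have e : nu = (2 + (2 * r + (nu - 2 * r.+1)))%N by lia.
  have sX : skew (b *: A2 F) by rewrite /skew linearZ /= sA scalerN.
  have [|sB rB kB] := core_kind (ZN := Z2 F) e sX _ (core_PlaneNondeg b0).
    by move=> l; apply: Z2_col.
  exists (bdiag nu (blk (b *: A2 F) :: tail r (nu - 2 * r.+1))), (Z2 F nu).
  rewrite rB rA // -mulnS; split=> //; rewrite -point_Z2 // bdiag_addl.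
    by rewrite /phi7 subn1.
  by rewrite bsize_tail.
- case/andP=> r1 /half0 hr; case: r r1 hr => [|[|r]] // _ hr.
  have e : nu = (4 + (2 * r + (nu - 2 * r.+2)))%N by lia.
  have sX : skew (Kmx F).
    by rewrite /skew tr_block_mx !trmx0 linearN /= !trmx1 opp_block_mx !oppr0 opprK.
  have [|sB rB kB] := core_kind (ZN := Z2 F) e sX _ core_PlaneIso.
    by move=> l; apply: Z2_col.
  exists (bdiag nu (blk (Kmx F) :: tail r (nu - 2 * r.+2))), (Z2 F nu).
  rewrite rB (mxrank_unit (symp_unit F 2)); split=> //; last by lia.
  by rewrite -point_Z2 // /phi8 subn2.
Qed.

End PhiKinds.

(** * Matching kinds with the list, and counting the orbits *)

Section Classification.

Variables (F : finFieldType) (nu : nat) (z : F) (Omega : {set F}).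
Hypotheses (nu2 : (2 <= nu)%N).
Hypotheses (z_nsq : ~~ is_square z) (z1_nsq : ~~ is_square (1 - z)).
Hypothesis Omega_cover :
  Omega :|: [set - x | x in Omega] = [set x : F | x != 0].
Hypothesis Omega_disj : Omega :&: [set - x | x in Omega] = set0.

Let z0 : z != 0 := z_neq0 z_nsq.

Lemma mem_oppOmega x : (x \in [set - y | y in Omega]) = (- x \in Omega).
Proof. by rewrite -{1}[x]opprK mem_imset //; apply: oppr_inj. Qed.

Lemma OmegaE x : x != 0 -> (x \in Omega) || (- x \in Omega).
Proof.
move=> x0; have : x \in [set x : F | x != 0] by rewrite inE.
by rewrite -Omega_cover !inE mem_oppOmega.
Qed.

Lemma Omega_anti x : x \in Omega -> - x \notin Omega.
Proof.
move=> xO; apply/negP => nxO; suff : x \in (set0 : {set F}) by rewrite inE.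
by rewrite -Omega_disj inE xO mem_oppOmega.
Qed.

Lemma Omega_neq0 x : x \in Omega -> x != 0.
Proof.
move=> xO; suff : x \in [set x : F | x != 0] by rewrite inE.
by rewrite -Omega_cover inE xO.
Qed.

(* In characteristic 2, [Omega] would meet [- Omega] = [Omega]. *)
Lemma two_neq0 : 2%:R != 0 :> F.
Proof.
apply/eqP => two0; have opp (x : F) : - x = x.
  by apply/eqP; rewrite eq_sym -subr_eq0 opprK -mulr2n -mulr_natl two0 mul0r.
have := OmegaE (oner_neq0 F); rewrite opp orbb => O1.
by have := Omega_anti O1; rewrite opp O1.
Qed.

Lemma card_Omega : #|F| = (#|Omega|.*2).+1.
Proof.
have := cardsC1 (0 : F); have -> : [set~ 0] = [set x : F | x != 0].
  by apply/setP => x; rewrite !inE.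
rewrite -Omega_cover cardsU Omega_disj cards0 subn0 card_imset; last exact: oppr_inj.
rewrite addnn => ->; rewrite prednK //.
by apply/card_gt0P; exists 0.
Qed.

Let char2 := two_neq0.

(** The reflection [R] is an isometry of determinant [-1], and congruence by [R] multiplies an
    alternating form on the plane by that determinant. *)
Lemma has_kind_opp n c (B : 'M[F]_n) (Z : 'M_(n, 2)) :
  has_kind z (KPlaneNondeg c) B Z -> has_kind z (KPlaneNondeg (- c)) B Z.
Proof.
pose R : 'M[F]_2 := mx_of_rows 2 2 [:: [:: 1; 0]; [:: 0; -1]].
have RR : R^T *m (c *: A2 F) *m R = - c *: A2 F.
  apply: (@mx2P F); rewrite !(mxE, big_ord_recl, big_ord0) /=; ring.
have oR : isO2 z R.
  apply/eqP/(@mx2P F); rewrite !(mxE, big_ord_recl, big_ord0) /=; ring.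
move=> [S oS [U [x [H [xB xU HJ eZ]]]]]; exists (S *m R); first exact: isO2_mul.
exists U, x, (R^T *m H); split=> //.
  by rewrite /= in HJ *; rewrite trmx_mul trmxK -RR -HJ !mulmxA.
by rewrite mulmxA eZ /= !mulmx0 !add0r !mulmx1 trmx_mul trmxK mulmxA.
Qed.

Lemma orbit_eq (B : 'M[F]_nu) (Z : 'M_(nu, 2)) V :
  V \in orbit01 z (point z B Z) -> orbit01 z V = orbit01 z (point z B Z).
Proof. by case/(orbit_pointP z0) => Y [S [uY oS ->]]; apply: orbit_act. Qed.

Lemma Omega0 : 0 \notin Omega.
Proof. by apply/negP=> /Omega_neq0; rewrite eqxx. Qed.

Lemma phi_kind_ok i : phi_index_ok nu Omega i -> kind_ok (phi_kind i).
Proof.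
case: i => [r|r a|r a|[|r]|r|r|r b|r] //=; rewrite ?eqxx ?orbT //.
- by case/andP.
- by case/andP.
- by case/andP => _ /Omega_neq0; rewrite invr_eq0.
Qed.

Lemma phi_kind_inj i j :
    phi_index_ok nu Omega i -> phi_index_ok nu Omega j ->
    phi_rank i = phi_rank j -> kind_equiv (phi_kind i) (phi_kind j) ->
  i = j.
Proof.
case: i => [r|r a|r a|[|r]|r|r|r b|r]; case: j => [s|s a'|s a'|[|s]|s|s|s b'|s] //= oi oj e.
all: try by rewrite ?e; case=> // ->.
all: try by rewrite ?e.
- by rewrite -e in oj.
- by case=> /eqP; rewrite eq_sym oner_eq0.
- by case=> /eqP; rewrite oner_eq0.
- by rewrite e in oi.
(* Two [Phi7] indices remain: equal squares mean [b = b'] or [b = - b'], and [Omega] excludes the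
   second. *)
move/eqP; rewrite eqf_sqr -invrN => /orP[] /eqP/invr_inj eb; first by rewrite e eb.
case/andP: oi oj => _ bO /andP[_ bO'].
by have := Omega_anti bO'; rewrite -eb bO.
Qed.

Lemma phi_orbit_inj i j :
    phi_index_ok nu Omega i -> phi_index_ok nu Omega j ->
    orbit01 z (phi nu z i) = orbit01 z (phi nu z j) ->
  i = j.
Proof.
move=> oi oj.
have [B [Z [-> sB rB kB]]] := phi_point char2 z_nsq nu2 Omega0 oi.
have [B' [Z' [-> sB' rB' kB']]] := phi_point char2 z_nsq nu2 Omega0 oj.
move=> eq_orb; have := mem_orbit_point z0 B' Z'; rewrite -eq_orb.
case/(orbit_pointP z0)=> Y [S [uY oS /point_inj[eB eZ]]].
apply: phi_kind_inj => //.
  apply/eqP; rewrite -(eqn_pmul2l (isT : 0 < 2)%N) -rB -rB' eB.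
  by rewrite mxrankMfree ?row_free_unit ?unitmx_tr // eqmxMfull // row_full_unit.
apply: (kind_unique z_nsq z1_nsq sB' (phi_kind_ok oi) (phi_kind_ok oj)) kB'.
by rewrite eB eZ; apply: has_kind_act.
Qed.

Lemma phi_orbit_P1 i : phi_index_ok nu Omega i ->
  orbit01 z (phi nu z i) <> orbit01 z (P1 F nu).
Proof.
move=> oi; have [B [Z [-> sB rB kB]]] := phi_point char2 z_nsq nu2 Omega0 oi.
have := mem_orbit_point z0 B Z; rewrite -(point0 nu z) => + eq_orb.
rewrite eq_orb => /(orbit_pointP z0)[Y [S [_ _ /point_inj[]]]].
rewrite !mulmx0 !mul0mx => B0 Z0; rewrite {}B0 {}Z0 mxrank0 in rB kB *.
have r0 : phi_rank i = 0%N by move/esym/eqP: rB; rewrite muln_eq0 => /eqP.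
have k0 : kind_equiv (phi_kind i) (KZero F).
  apply: (kind_unique (k' := KZero F) z_nsq z1_nsq (skew0 F nu) _ _ kB) => //.
    exact: phi_kind_ok.
  exact/(has_kind_zeroP z_nsq).
by case: i oi r0 k0 {kB rB} => [r|r a|r a|[|r]|r|r|r b|r] //= + r0; rewrite r0.
Qed.

Lemma rank_half n r a : (2 * r + a <= n)%N -> (r <= (n - a) %/ 2)%N.
Proof. by move=> h; rewrite leq_divRL // mulnC; lia. Qed.

Lemma phi_exists U : U \in Lambda nu z :\ P1 F nu ->
  exists2 i, phi_index_ok nu Omega i & U \in orbit01 z (phi nu z i).
Proof.
case/setD1P=> U1 /(LambdaP _ _ char2)[B [Z [sB eU]]].
have [k ok kB] := has_kind_exists char2 z_nsq z1_nsq Z sB.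
have [b1 b2] := has_kind_bounds ok sB kB.
have [r rB] : exists r, \rank B = (2 * r)%N.
  exists (\rank B)./2; rewrite mul2n -[LHS]odd_double_half.
  by rewrite (negPf (skew_rank_even char2 sB)).
rewrite rB in b1 b2.
suff [i oi [ri ki]] : exists2 i, phi_index_ok nu Omega i &
    phi_rank i = r /\ has_kind z (phi_kind i) B Z.
  exists i => //; have [B' [Z' [-> sB' rB' kB']]] := phi_point char2 z_nsq nu2 Omega0 oi.
  apply/(orbit_pointP z0).
  have [|Y [S [uY oS eB eZ]]] := has_kind_equiv char2 z_nsq (phi_kind_ok oi) sB' sB _ kB' ki.
    by rewrite rB' ri rB.
  by exists Y, S; rewrite eU eB eZ.
case: k ok kB b1 b2 => [|a|a|a||c|] /= ok kB b1 /rank_half b2.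
- exists (Phi1 F r) => //=; rewrite subn0 in b2; rewrite b2 andbT lt0n.
  apply: contraNneq U1 => r0; move/(has_kind_zeroP z_nsq): kB eU => ->.
  have -> : B = 0 by apply/eqP; rewrite -mxrank_eq0 rB r0.
  by rewrite point0 => ->.
- by exists (Phi2 r a) => //=; rewrite b2.
- exists (Phi3 r a) => //=; rewrite subn0 in b2; rewrite b2 ok !andbT; lia.
- case/orP: ok kB => /eqP-> kB.
    exists (Phi4 F r) => /=; first by [].
    by case: r b1 {b2 rB} => // r; rewrite muln0.
  exists (Phi5 F r) => //=; rewrite b2 andbT; lia.
- case: (posnP r) => [r0 | r_gt0]; first by exists (Phi4 F 0).
  by exists (Phi6 F r) => //=; rewrite b2 r_gt0.
(* [Phi7 r b] realises the parameter [b^-1], and one of [c^-1] and [- c^-1] lies in [Omega]. *)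
- rewrite subn0 in b2; have ci0 : c^-1 != 0 by rewrite invr_eq0.
  case/orP: (OmegaE ci0) => cO.
    by exists (Phi7 r c^-1) => //=; rewrite ?invrK // b2 cO !andbT; lia.
  exists (Phi7 r (- c^-1)) => //=; first by rewrite b2 cO !andbT; lia.
  by rewrite invrN invrK; split=> //; apply: has_kind_opp.
- by exists (Phi8 F r) => //=; rewrite subn0 in b2; rewrite b2 andbT; lia.
Qed.

(** A finite copy of the admissible indices, to be counted: [unit] stands for [P1], the families
    follow in order, and [bool] encodes [a]. The last factor is [nu %/ 2 - 1] because [Phi8] starts
    at [r = 2]. *)
Definition index_type : finType :=
  (unit + ('I_(nu %/ 2) + ('I_((nu - 1) %/ 2).+1 * bool + ('I_(nu %/ 2) * bool +
   ('I_((nu - 1) %/ 2).+1 + ('I_((nu - 1) %/ 2) + ('I_((nu - 2) %/ 2) +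
   ('I_(nu %/ 2) * {x | x \in Omega} + 'I_(nu %/ 2 - 1)))))))))%type.

Definition index_of (t : index_type) : option (phi_index F) :=
  match t with
  | inl _ => None
  | inr (inl r) => Some (Phi1 F r.+1)
  | inr (inr (inl (r, a))) => Some (Phi2 r a%:R)
  | inr (inr (inr (inl (r, a)))) => Some (Phi3 r.+1 a%:R)
  | inr (inr (inr (inr (inl r)))) => Some (Phi4 F r)
  | inr (inr (inr (inr (inr (inl r))))) => Some (Phi5 F r.+1)
  | inr (inr (inr (inr (inr (inr (inl r)))))) => Some (Phi6 F r.+1)
  | inr (inr (inr (inr (inr (inr (inr (inl (r, b)))))))) => Some (Phi7 r.+1 (val b))
  | inr (inr (inr (inr (inr (inr (inr (inr r))))))) => Some (Phi8 F r.+2)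
  end.

Lemma index_of_ok t : if index_of t is Some i then phi_index_ok nu Omega i else true.
Proof.
have a01 (a : bool) : (a%:R == 0 :> F) || (a%:R == 1 :> F).
  by case: a; rewrite ?eqxx ?orbT.
case: t => [[]|[r|[[r a]|[[r a]|[r|[r|[r|[[r b]|r]]]]]]]] //=; rewrite ?a01 ?(valP b) ?andbT.
all: by have := ltn_ord r; lia.
Qed.

Lemma index_of_inj : injective index_of.
Proof.
have bool_inj (a a' : bool) : a%:R = a'%:R :> F -> a = a'.
  case: a; case: a' => // /eqP; rewrite ?oner_eq0 // eq_sym oner_eq0 //.
move=> [[]|[r|[[r a]|[[r a]|[r|[r|[r|[[r b]|r]]]]]]]];
  move=> [[]|[s|[[s a']|[[s a']|[s|[s|[s|[[s b']|s]]]]]]]] //= [].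
- by move/val_inj->.
- by move=> /val_inj-> /bool_inj->.
- by move=> /val_inj-> /bool_inj->.
- by move/val_inj->.
- by move/val_inj->.
- by move/val_inj->.
- by move=> /val_inj-> /val_inj->.
- by move/val_inj->.
Qed.

Lemma index_of_surj i : phi_index_ok nu Omega i -> exists t, index_of t = Some i.
Proof.
have bnd (r m : nat) : (0 < r <= m)%N -> exists s : 'I_m, s.+1 = r.
  by case: r => [|r] //= rm; exists (Ordinal rm).
have bnd0 (r m : nat) : (r <= m)%N -> exists s : 'I_m.+1, s = r :> nat.
  by rewrite -ltnS => rm; exists (Ordinal rm).
have a01 (a : F) : (a == 0) || (a == 1) -> exists b : bool, b%:R = a.
  by case/orP => /eqP->; [exists false | exists true].
case: i => [r|r a|r a|r|r|r|r b|r] /=.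
- by case/bnd=> s <-; exists (inr (inl s)).
- case/andP=> /bnd0[s <-] /a01[b <-].
  by exists (inr (inr (inl (s, b)))).
- case/andP=> /bnd[s <-] /a01[b <-].
  by exists (inr (inr (inr (inl (s, b))))).
- by case/bnd0=> s <-; exists (inr (inr (inr (inr (inl s))))).
- by case/bnd=> s <-; exists (inr (inr (inr (inr (inr (inl s)))))).
- by case/bnd=> s <-; exists (inr (inr (inr (inr (inr (inr (inl s))))))).
- case/andP=> /bnd[s <-] bO.
  by exists (inr (inr (inr (inr (inr (inr (inr (inl (s, exist _ b bO))))))))).
- move=> hr; have /bnd[s es] : (0 < r - 1 <= nu %/ 2 - 1)%N by lia.
  exists (inr (inr (inr (inr (inr (inr (inr (inr s)))))))) => /=.
  by congr (Some (Phi8 F _)); lia.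
Qed.

Definition index_orbit (o : option (phi_index F)) :=
  orbit01 z (if o is Some i then phi nu z i else P1 F nu).

Lemma orbits_Lambda :
  [set orbit01 z U | U in Lambda nu z] = [set index_orbit (index_of t) | t : index_type].
Proof.
apply/setP=> V; apply/imsetP/imsetP => [[U UL ->] | [t _ ->]].
  have [-> | U_neq] := eqVneq U (P1 F nu); first by exists (inl tt).
  have [|i oi Ui] := @phi_exists U; first by rewrite !inE U_neq.
  have [t et] := index_of_surj oi; exists t => //; rewrite et /=.
  have [B [Z [eB _ _ _]]] := phi_point char2 z_nsq nu2 Omega0 oi.
  by rewrite /index_orbit eB in Ui *; apply: orbit_eq.
have := index_of_ok t; rewrite /index_orbit; case: (index_of t) => [i oi | _].
  have [B [Z [eB sB _ _]]] := phi_point char2 z_nsq nu2 Omega0 oi.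
  by exists (phi nu z i) => //; apply/(LambdaP _ _ char2); exists B, Z.
exists (P1 F nu) => //; apply/(LambdaP _ _ char2); exists 0, 0.
by rewrite point0; split=> //; apply: skew0.
Qed.

Lemma index_orbit_inj : injective (index_orbit \o index_of).
Proof.
move=> t t' /= e; apply: index_of_inj.
move: e (index_of_ok t) (index_of_ok t').
case: (index_of t) => [i|]; case: (index_of t') => [j|] //= e oi oj.
- by congr Some; apply: phi_orbit_inj.
- by case: (phi_orbit_P1 oi).
- by case: (phi_orbit_P1 oj).
Qed.

Lemma rank_G0E :
  rank_G0 nu z = ((#|F| + 7) %/ 2 * (nu %/ 2) + 4 * ((nu - 1) %/ 2)
                  + (nu - 2) %/ 2 + 3)%N.
Proof.
rewrite /rank_G0 orbits_Lambda (card_imset _ index_orbit_inj) card_Omega.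
rewrite !card_sum !card_prod !card_ord card_unit card_bool card_sig.
(* For each [r] up to [nu %/ 2], [Phi7] contributes [#|Omega|] orbits; the other four come from
   [Phi1], the two values of [a] in [Phi3], and [Phi8], which misses [r = 1]. *)
have -> : ((#|Omega|.*2.+1 + 7) %/ 2 = #|Omega| + 4)%N by lia.
(* Keeps the subtraction in [nu %/ 2 - 1] from being truncated. *)
have : (1 <= nu %/ 2)%N by rewrite divn_gt0.
rewrite mulnDl mulnC; move: (#|Omega|) => w; nia.
Qed.

End Classification.

Theorem theorem2p4 (F : finFieldType) (q : nat) (hq : #|F| = q) (q_odd : odd q)
  (nu : nat) (hnu : (2 <= nu)%N)
  (z : F) (z_nsq : ~~ is_square z) (z1_nsq : ~~ is_square (1 - z))
  (Omega : {set F})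
  (Omega_cover : Omega :|: [set - x | x in Omega] = [set x : F | x != 0])
  (Omega_disj : Omega :&: [set - x | x in Omega] = set0) :
  [/\ forall U, U \in Lambda nu z :\ P1 F nu ->
        exists! i : phi_index F,
          phi_index_ok nu Omega i /\ U \in orbit01 z (phi nu z i),
      forall i j : phi_index F,
        phi_index_ok nu Omega i -> phi_index_ok nu Omega j -> i <> j ->
        orbit01 z (phi nu z i) != orbit01 z (phi nu z j)
    & rank_G0 nu z
      = ((q + 7) %/ 2 * (nu %/ 2) + 4 * ((nu - 1) %/ 2) + (nu - 2) %/ 2 + 3)%N].
Proof.
have inj := phi_orbit_inj hnu z_nsq z1_nsq Omega_cover Omega_disj.
split.
- move=> U /(phi_exists hnu z_nsq z1_nsq Omega_cover Omega_disj)[i oi Ui].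
  exists i; split=> // j [oj Uj]; apply: inj => //.
  have char2 := two_neq0 Omega_cover Omega_disj; have O0 := Omega0 Omega_cover.
  have [B [Z [eB _ _ _]]] := phi_point char2 z_nsq hnu O0 oi.
  have [B' [Z' [eB' _ _ _]]] := phi_point char2 z_nsq hnu O0 oj.
  rewrite eB eB' in Ui Uj *.
  by rewrite -(orbit_eq z_nsq Ui) -(orbit_eq z_nsq Uj).
- by move=> i j oi oj ij; apply/eqP => /(inj _ _ oi oj).
- by rewrite -hq; apply: rank_G0E Omega_cover Omega_disj.
Qed.
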